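(* Let $0\le\lambda<\gamma\le\delta$ and let $\mathfrak{f}=\mathfrak{s}+\overline{\mathfrak{t}}\in\mathcal{R}_H^0(\gamma,\delta,\lambda)$. Let $$pc(r)=(-\delta-2\gamma+\lambda)r^3+(3\delta+6\gamma-3\lambda)r^2+(-3\delta-7\gamma+4\lambda)r+\delta+\gamma.$$ Then $pc(r)=0$ has a unique real root $r_c$ in $(0,1)$, and $\mathfrak{f}$ is fully convex in $|z|<r_c$.
   Context: Let $\mathcal{U}=\{z\in\mathbb{C}:|z|<1\}$. $\mathcal{H}^0$ denotes the class of complex-valued harmonic functions $\mathfrak{f}=\mathfrak{s}+\overline{\mathfrak{t}}$ on $\mathcal{U}$, where $\mathfrak{s}(z)=z+\sum_{m\ge2}a_mz^m$ and $\mathfrak{t}(z)=\sum_{m\ge2}b_mz^m$ are analytic in $\mathcal{U}$. For real $0\le\lambda<\gamma\le\delta$, $\mathcal{R}_H^0(\gamma,\delta,\lambda)$ is the class of $\mathfrak{f}=\mathfrak{s}+\overline{\mathfrak{t}}\in\mathcal{H}^0$ such that for all $z\in\mathcal{U}$, $\mathrm{Re}\left[\gamma\mathfrak{s}'(z)+\delta z\mathfrak{s}''(z)+\frac{\delta-\gamma}{2}z^2\mathfrak{s}'''(z)-\lambda\right]>\left|\gamma\mathfrak{t}'(z)+\delta z\mathfrak{t}''(z)+\frac{\delta-\gamma}{2}z^2\mathfrak{t}'''(z)\right|$. A harmonic function $\mathfrak{f}$ is fully convex in the disk $|z|<R$ if it maps every circle $|z|=\rho$, $0<\rho<R$, in a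 one-to-one manner onto a convex curve (equivalently, for each $0<r<R$ the function $\mathfrak{f}(rz)/r$ maps every circle $|z|=\rho<1$ one-to-one onto a convex curve). *)

(* Defs.v *)
From Stdlib Require Import Reals.
From Coquelicot Require Import Coquelicot.
Open Scope R_scope.

Definition in_disk (z : C) : Prop := Cmod z < 1.

Definition cderiv (g : C -> C) (z l : C) : Prop :=
  @is_derive C_AbsRing C_NormedModule g z l.

Definition series_on_disk (g : C -> C) (c : nat -> C) : Prop :=
  forall z, in_disk z -> @is_pseries C_AbsRing C_NormedModule c z (g z).

Definition normalized_s (s : C -> C) : Prop :=
  exists a : nat -> C, a 0%nat = 0%C /\ a 1%nat = 1%C /\ series_on_disk s a.

Definition normalized_t (t : C -> C) : Prop :=
  exists b : nat -> C, b 0%nat = 0%C /\ b 1%nat = 0%C /\ series_on_disk t b.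

Definition derivs3_on_disk (g g1 g2 g3 : C -> C) : Prop :=
  forall z, in_disk z ->
    cderiv g z (g1 z) /\ cderiv g1 z (g2 z) /\ cderiv g2 z (g3 z).

Definition Lop (gam del : R) (h1 h2 h3 : C -> C) (z : C) : C :=
  (RtoC gam * h1 z + RtoC del * z * h2 z
   + RtoC ((del - gam) / 2) * (z * z) * h3 z)%C.

Definition in_RH0 (gam del lam : R) (s s1 s2 s3 t t1 t2 t3 : C -> C) : Prop :=
  normalized_s s /\ normalized_t t /\
  derivs3_on_disk s s1 s2 s3 /\ derivs3_on_disk t t1 t2 t3 /\
  forall z, in_disk z ->
    Re (Lop gam del s1 s2 s3 z - RtoC lam)%C > Cmod (Lop gam del t1 t2 t3 z).

Definition harm (s t : C -> C) (z : C) : C := (s z + Cconj (t z))%C.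

Definition polar (rho theta : R) : C := (rho * cos theta, rho * sin theta).

Definition convex_set (K : C -> Prop) : Prop :=
  forall x y (u : R), K x -> K y -> 0 <= u <= 1 ->
    K (RtoC (1 - u) * x + RtoC u * y)%C.

Definition interior_pt (K : C -> Prop) (p : C) : Prop :=
  exists eps, 0 < eps /\ forall q, Cmod (q - p)%C < eps -> K q.

Definition closure_pt (K : C -> Prop) (p : C) : Prop :=
  forall eps, 0 < eps -> exists q, K q /\ Cmod (q - p)%C < eps.

Definition boundary_pt (K : C -> Prop) (p : C) : Prop :=
  closure_pt K p /\ ~ interior_pt K p.

Definition convex_curve (S : C -> Prop) : Prop :=
  exists K : C -> Prop,
    convex_set K /\ (exists M, forall q, K q -> Cmod q <= M) /\
    (exists p, interior_pt K p) /\
    forall p, S p <-> boundary_pt K p.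

Definition circle_onto_convex (f : C -> C) (rho : R) : Prop :=
  (forall th1 th2, 0 <= th1 < 2 * PI -> 0 <= th2 < 2 * PI ->
     f (polar rho th1) = f (polar rho th2) -> th1 = th2) /\
  convex_curve (fun w => exists th, 0 <= th < 2 * PI /\ w = f (polar rho th)).

Definition fully_convex_in (f : C -> C) (R0 : R) : Prop :=
  forall rho, 0 < rho < R0 -> circle_onto_convex f rho.

Definition pc (gam del lam r : R) : R :=
  (- del - 2 * gam + lam) * r ^ 3 + (3 * del + 6 * gam - 3 * lam) * r ^ 2
  + (- 3 * del - 7 * gam + 4 * lam) * r + del + gam.

(* Main.v *)
(* Caratheodory's coefficient inequality, applied for every unimodular u to
   L[s] - lambda + u L[t], where L is the differential operator of the class,
   gives n^2 (|a_n| + |b_n|) <= 4 (gamma - lambda) / (gamma + delta) for n >= 2.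
   Since pc(r) = (gamma + delta) (1 - r)^3 - (gamma - lambda) (r^3 - 3 r^2 + 4 r),
   summing a geometric series yields
   sum_(n >= 2) n^2 (|a_n| + |b_n|) rho^n < rho for all rho < r_c.

   Under this coefficient condition the image of |z| = rho is a small
   perturbation of a circle.  It is injectively parametrized, and it is the
   boundary of the intersection of the half-planes cut out by its tangent
   lines.  That the curve lies in all these half-planes is a finite-difference
   form of the classical estimate |X - Y| <= |X + Y|, which means
   Re (conj X * Y) >= 0.  A boundary point p of the intersection lies, by
   compactness, on some tangent line; positive curvature at the point of
   tangency then forces p to be that point. *)

Require Import Defs.
From Stdlib Require Import Reals Arith Lra Lia Psatz IndefiniteDescription.
From Coquelicot Require Import Coquelicot.
Open Scope R_scope.

(** * Unimodular numbers and the real inner product *)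

(** The obstacle is the conjugated part. On the circle, a point [w] moves to [w * z] with |z| = 1,
    and |z - 1|^2 = 2 e for e = 1 - Re z, so second-order remainders are measured by e. For A w^n,
    removing the tangential motion leaves the factor q = z^n - 1 - i n Im z; q + n e is z^n - 1 - n
    (z - 1), of size at most (n^2 - n) e, and q - n e is of size at most (n^2 + n) e. Under the
    conjugation the normal carries -n, so the roles of n^2 - n and n^2 + n are exchanged. Neither
    modulus alone is controlled by n^2, but their sum is bounded by 2 n^2 e for both kinds of term,
    and a bound on the sum is just what |X - Y| <= |X + Y| asks for. This is why n^2 (|a_n| + |b_n|)
    is the right weight. Working with differences also compares any two points of the circle at
    once: the supporting half-planes are obtained globally, without turning angles or a passage from
    local to global convexity. Curvature is needed only to identify the points of contact. *)

Definition dot (x y : C) : R := Re x * Re y + Im x * Im y.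

Lemma Cmod_sqr (x : C) : Cmod x * Cmod x = dot x x.
Proof.
  replace (Cmod x * Cmod x) with (Cmod x ^ 2) by ring.
  rewrite Cmod2_alt; unfold dot; ring.
Qed.

Lemma dot_le_Cmod (x y : C) : Rabs (dot x y) <= Cmod x * Cmod y.
Proof.
  assert (Hx := Cmod_ge_0 x); assert (Hy := Cmod_ge_0 y).
  rewrite <- (Rabs_pos_eq (Cmod x * Cmod y)) by nra.
  apply Rsqr_le_abs_0. unfold Rsqr.
  replace (Cmod x * Cmod y * (Cmod x * Cmod y))
    with ((Cmod x * Cmod x) * (Cmod y * Cmod y)) by ring.
  rewrite !Cmod_sqr; unfold dot.
  assert (H := Rle_0_sqr (Re x * Im y - Im x * Re y)); unfold Rsqr in H; nra.
Qed.

Lemma dot_ge_opp_Cmod (x y : C) : - (Cmod x * Cmod y) <= dot x y.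
Proof. exact (proj1 (proj1 (Rabs_le_between _ _) (dot_le_Cmod x y))). Qed.

Lemma dot_le (x y : C) : dot x y <= Cmod x * Cmod y.
Proof. eapply Rle_trans; [apply Rle_abs | apply dot_le_Cmod]. Qed.

Lemma Cmod_triangle_rev (x y : C) : Cmod x - Cmod y <= Cmod (x + y)%C.
Proof.
  assert (H := Cmod_triangle (x + y) (- y)).
  rewrite Cmod_opp in H.
  replace (x + y + - y)%C with x in H by ring. lra.
Qed.

Lemma Cmod_minus_sym (x y : C) : Cmod (x - y)%C = Cmod (y - x)%C.
Proof. rewrite <- Cmod_opp. f_equal; ring. Qed.

Lemma dot_pos_of_Cmod_le (x y : C) :
  Cmod (x - y)%C <= Cmod (x + y)%C -> 0 <= dot x y.
Proof.
  intros H. assert (H0 := Cmod_ge_0 (x - y)).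
  assert (H1 : Cmod (x - y)%C * Cmod (x - y)%C <= Cmod (x + y)%C * Cmod (x + y)%C) by nra.
  rewrite !Cmod_sqr in H1; unfold dot in *; destruct x, y; simpl in *; nra.
Qed.

Lemma dot_pos_of_Cmod_lt (x y : C) :
  Cmod (x - y)%C < Cmod (x + y)%C -> 0 < dot x y.
Proof.
  intros H. assert (H0 := Cmod_ge_0 (x - y)).
  assert (H1 : Cmod (x - y)%C * Cmod (x - y)%C < Cmod (x + y)%C * Cmod (x + y)%C) by nra.
  rewrite !Cmod_sqr in H1; unfold dot in *; destruct x, y; simpl in *; nra.
Qed.

Lemma Cmod_RtoC_mult (a : R) (x : C) : 0 <= a -> Cmod (RtoC a * x)%C = a * Cmod x.
Proof. intros; rewrite Cmod_mult, Cmod_R, Rabs_pos_eq; auto. Qed.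

Lemma Cmod_le_0_eq (x : C) : Cmod x <= 0 -> x = 0%C.
Proof. intros H; apply Cmod_eq_0, Rle_antisym; auto; apply Cmod_ge_0. Qed.

Lemma unit_Re_le (z : C) : Cmod z = 1 -> Re z <= 1.
Proof.
  intros H; assert (H1 := re_le_Cmod z); rewrite H in H1.
  apply Rabs_le_between in H1; lra.
Qed.

Lemma unit_eq (z : C) : Cmod z = 1 -> Re z * Re z + Im z * Im z = 1.
Proof. intros H; change (dot z z = 1); rewrite <- Cmod_sqr, H; ring. Qed.

Lemma unit_dist_1 (z : C) :
  Cmod z = 1 -> Cmod (z - 1)%C * Cmod (z - 1)%C = 2 * (1 - Re z).
Proof.
  intros H; apply unit_eq in H. rewrite Cmod_sqr; unfold dot.
  destruct z; simpl in *; nra.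
Qed.

Lemma Ceq_Re_Im (z : C) : z = (RtoC (Re z) + Ci * RtoC (Im z))%C.
Proof. destruct z; apply injective_projections; simpl; ring. Qed.

Lemma orthogonal_decomposition (x v : C) : 0 < dot x x -> dot x v = 0 ->
  v = (RtoC (dot (Ci * x) v / dot x x) * (Ci * x))%C.
Proof.
  intros H E. set (c := dot (Ci * x) v / dot x x).
  assert (Hc : c * dot x x = dot (Ci * x) v) by (unfold c; field; lra).
  clearbody c. destruct x as [a b], v as [u w]; unfold dot in *; simpl in *.
  assert (Ha := f_equal (Rmult a) Hc). assert (Hb := f_equal (Rmult b) Hc).
  assert (Ea := f_equal (Rmult a) E). assert (Eb := f_equal (Rmult b) E).
  apply injective_projections; simpl;
    (apply Rmult_eq_reg_l with (a * a + b * b); [lra | apply Rgt_not_eq; lra]).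
Qed.

Lemma Cmod_polar1 (th : R) : Cmod (polar 1 th) = 1.
Proof.
  unfold Cmod, polar; simpl.
  replace (1 * cos th * (1 * cos th * 1) + 1 * sin th * (1 * sin th * 1)) with 1.
  - apply sqrt_1.
  - assert (H := sin2_cos2 th); unfold Rsqr in H; lra.
Qed.

Lemma unit_is_polar (w : C) : Cmod w = 1 ->
  exists th, 0 <= th < 2 * PI /\ w = polar 1 th.
Proof.
  intros H. apply unit_eq in H. destruct w as [x y]; simpl in H.
  assert (Hx : -1 <= x <= 1) by nra. assert (Pi := PI_RGT_0).
  assert (B := acos_bound x). assert (Cx := cos_acos x Hx).
  assert (Sx := sin_acos x Hx). unfold Rsqr in Sx.
  replace (1 - x * x) with (y * y) in Sx by lra.
  destruct (Rle_lt_dec 0 y) as [Hy | Hy].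
  - exists (acos x). split; [lra|]. rewrite sqrt_square in Sx by auto.
    unfold polar; rewrite Cx, Sx, !Rmult_1_l; auto.
  - exists (2 * PI - acos x). split.
    (* The interval is half-open, so [acos x = 0] must be excluded: it would force [x = 1], hence
       [y = 0], against [y < 0]. *)
    + destruct (Req_dec (acos x) 0) as [E | E]; [|lra].
      rewrite E, cos_0 in Cx. subst x. nra.
    + replace (y * y) with (- y * - y) in Sx by ring.
      rewrite sqrt_square in Sx by lra.
      unfold polar. rewrite cos_minus, sin_minus, cos_2PI, sin_2PI, Cx, Sx.
      apply injective_projections; simpl; ring.
Qed.

Lemma polar1_inj (a b : R) : 0 <= a < 2 * PI -> 0 <= b < 2 * PI ->
  polar 1 a = polar 1 b -> a = b.
Proof.
  assert (W : forall a b, 0 <= a -> b < 2 * PI -> a < b -> polar 1 a <> polar 1 b).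
  { intros x y Hx Hy L E. injection E as E1 E2.
    assert (F : cos (y - x) = 1).
    { rewrite cos_minus. assert (H := sin2_cos2 y); unfold Rsqr in H.
      replace (cos x) with (cos y) by lra. replace (sin x) with (sin y) by lra. lra. }
    replace (y - x) with (2 * ((y - x) / 2)) in F by field.
    rewrite cos_2a_sin in F.
    assert (0 < sin ((y - x) / 2)) by (apply sin_gt_0; lra). nra. }
  intros Ha Hb E. destruct (Rtotal_order a b) as [L | [L | L]]; auto; exfalso.
  - apply (W a b); tauto.
  - apply (W b a); try tauto. auto.
Qed.

(** A chord is no longer than its arc: its square is 4 sin^2 ((a - b) / 2), and |sin x| <= |x|. *)
Lemma polar1_lipschitz (a b : R) : Cmod (polar 1 a - polar 1 b)%C <= Rabs (a - b).
Proof.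
  assert (W : forall x, 0 <= x -> Rabs (sin x) <= x).
  { intros x [Hx | <-]; [|rewrite sin_0, Rabs_R0; lra].
    apply Rabs_le. assert (A := sin_lt_x x Hx). split; [|lra].
    destruct (Rle_lt_dec x 1) as [L | L].
    - assert (0 < sin x) by (apply sin_gt_0; auto; generalize PI2_1; unfold PI2; lra). lra.
    - generalize (SIN_bound x); lra. }
  assert (S2 : forall x, sin x * sin x <= x * x).
  { intros x. destruct (Rle_lt_dec 0 x) as [L | L].
    - assert (A := W x L). apply Rabs_le_between in A. nra.
    - assert (A := W (- x)). rewrite sin_neg, Rabs_Ropp in A.
      assert (B : Rabs (sin x) <= - x) by (apply A; lra). apply Rabs_le_between in B. nra. }
  apply Rsqr_incr_0; auto using Cmod_ge_0, Rabs_pos.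
  rewrite <- Rsqr_abs. unfold Rsqr. rewrite Cmod_sqr.
  assert (H := cos_minus a b).
  replace (a - b) with (2 * ((a - b) / 2)) in H by field.
  rewrite cos_2a_sin in H. assert (Q := S2 ((a - b) / 2)).
  assert (Ea := sin2_cos2 a); assert (Eb := sin2_cos2 b); unfold Rsqr in *.
  unfold dot, polar; simpl. nra.
Qed.

(** * Complex power series *)

Notation cseries := (@is_series C_AbsRing C_NormedModule).
Notation csum x n := (@sum_n C_NormedModule x n : C).

Lemma cseries_eps (x : nat -> C) (l : C) :
  cseries x l <->
  forall eps, 0 < eps -> exists N, forall n, (N <= n)%nat -> Cmod (csum x n - l)%C < eps.
Proof.
  unfold is_series. split.
  - intros H eps Heps.
    destruct (proj1 (filterlim_locally_ball_norm _ _) H (mkposreal eps Heps)) as [N HN].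
    exists N; intros n Hn. apply (HN n Hn).
  - intros H. apply (proj2 (filterlim_locally_ball_norm _ _)). intros eps.
    destruct (H eps (cond_pos eps)) as [N HN]. exists N; intros n Hn. apply (HN n Hn).
Qed.

Lemma csum_conj (x : nat -> C) (n : nat) :
  csum (fun k => Cconj (x k)) n = Cconj (csum x n).
Proof.
  induction n as [|n IH]; [rewrite !sum_O; auto|].
  rewrite !sum_Sn, IH. apply injective_projections; simpl; ring.
Qed.

Lemma cseries_conj (x : nat -> C) (l : C) :
  cseries x l -> cseries (fun n => Cconj (x n)) (Cconj l).
Proof.
  rewrite !cseries_eps. intros H eps Heps. destruct (H eps Heps) as [N HN].
  exists N; intros n Hn. rewrite csum_conj, <- Cmod_conj.
  replace (Cconj (Cconj (csum x n) - Cconj l))%C with (csum x n - l)%C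
    by (apply injective_projections; simpl; ring).
  auto.
Qed.

Lemma cseries_ext (x y : nat -> C) (l : C) :
  (forall n, x n = y n) -> cseries x l -> cseries y l.
Proof. intros H; apply is_series_ext; auto. Qed.

Lemma cseries_plus (x y : nat -> C) (l m : C) :
  cseries x l -> cseries y m -> cseries (fun n => x n + y n)%C (l + m)%C.
Proof. intros; apply (is_series_plus x y l m); auto. Qed.

Lemma cseries_scal (a : C) (x : nat -> C) (l : C) :
  cseries x l -> cseries (fun n => a * x n)%C (a * l)%C.
Proof. intros; apply (is_series_scal a x l); auto. Qed.

Lemma cseries_minus (x y : nat -> C) (l m : C) :
  cseries x l -> cseries y m -> cseries (fun n => x n - y n)%C (l - m)%C.
Proof. intros; apply (is_series_minus x y l m); auto. Qed.

Lemma Cmod_csum_le (x : nat -> C) (y : nat -> R) (n : nat) :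
  (forall k, Cmod (x k) <= y k) -> Cmod (csum x n) <= sum_n y n.
Proof.
  intros H. induction n as [|n IH]; [rewrite !sum_O; auto|].
  rewrite !sum_Sn. eapply Rle_trans; [apply Cmod_triangle|].
  apply Rplus_le_compat; auto.
Qed.

Lemma cseries_Cmod_le (x : nat -> C) (y : nat -> R) (l : C) (Y : R) :
  (forall n, Cmod (x n) <= y n) -> cseries x l -> is_series y Y -> Cmod l <= Y.
Proof.
  intros H Hx Hy. apply Rnot_lt_le; intros L.
  rewrite cseries_eps in Hx. set (e := (Cmod l - Y) / 2).
  assert (He : 0 < e) by (unfold e; lra).
  destruct (Hx e He) as [N HN].
  assert (Hy' : is_lim_seq (sum_n y) Y) by exact Hy.
  apply is_lim_seq_spec in Hy'. destruct (Hy' (mkposreal e He)) as [M HM].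
  specialize (HN (max N M) ltac:(lia)). specialize (HM (max N M) ltac:(lia)).
  simpl in HM. apply Rabs_lt_between in HM.
  assert (A := Cmod_csum_le x y (max N M) H).
  assert (B := Cmod_triangle (csum x (max N M)) (- (csum x (max N M) - l))).
  rewrite Cmod_opp in B.
  replace (csum x (max N M) + - (csum x (max N M) - l))%C with l in B by ring.
  unfold e in *; lra.
Qed.

Lemma cseries_dominated (x : nat -> C) (y : nat -> R) :
  (forall n, Cmod (x n) <= y n) -> ex_series y -> exists l, cseries x l.
Proof.
  intros H Hy.
  assert (A := @ex_series_le C_AbsRing C_CompleteNormedModule x y).
  apply A; auto.
Qed.

Lemma C_pow_n (z : C) (n : nat) : @pow_n C_Ring z n = (z ^ n)%C.
Proof. induction n as [|n IH]; [reflexivity | exact (f_equal (Cmult z) IH)]. Qed.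

Lemma pseries_cseries (c : nat -> C) (z l : C) :
  @is_pseries C_AbsRing C_NormedModule c z l <-> cseries (fun n => z ^ n * c n)%C l.
Proof.
  unfold is_pseries; split; apply is_series_ext; intros n;
    [| symmetry]; exact (f_equal (fun w => Cmult w (c n)) (C_pow_n z n)).
Qed.

(** Induction on E_(n+1) = x E_n + n y^(n-1) (x - y)^2, where E_n is the first-order Taylor
    remainder. The factor [r * r] on the left avoids the exponent n - 2; [pred n] at [n = 0] is
    multiplied by zero. The bound serves termwise differentiation and, with r = 1, second
    differences on the unit circle. *)
Lemma pow_taylor (x y : C) (r : R) (n : nat) : 0 < r -> Cmod x <= r -> Cmod y <= r ->
  r * r * Cmod (x ^ n - y ^ n - RtoC (INR n) * y ^ pred n * (x - y))%C
  <= INR n * (INR n - 1) / 2 * r ^ n * (Cmod (x - y)%C * Cmod (x - y)%C).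
Proof.
  intros Hr Hx Hy. induction n as [|n IH].
  - replace (x ^ 0 - y ^ 0 - RtoC (INR 0) * y ^ pred 0 * (x - y))%C with (RtoC 0)
      by (simpl; ring).
    rewrite Cmod_0; simpl; lra.
  - set (E := (x ^ n - y ^ n - RtoC (INR n) * y ^ pred n * (x - y))%C) in *.
    replace (x ^ S n - y ^ S n - RtoC (INR (S n)) * y ^ pred (S n) * (x - y))%C
      with (x * E + RtoC (INR n) * y ^ pred n * ((x - y) * (x - y)))%C.
    2:{ unfold E. rewrite S_INR, RtoC_plus. destruct n as [|n]; simpl; ring. }
    assert (T := Cmod_triangle (x * E) (RtoC (INR n) * y ^ pred n * ((x - y) * (x - y)))).
    rewrite !Cmod_mult, Cmod_R, Rabs_pos_eq in T by apply pos_INR.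
    rewrite Cmod_pow in T.
    set (h := Cmod (x - y)%C) in *. assert (Hh : 0 <= h) by apply Cmod_ge_0.
    assert (HE := Cmod_ge_0 E). assert (Hn := pos_INR n).
    assert (Py : INR n * (r * Cmod y ^ pred n) <= INR n * r ^ n).
    { destruct n as [|n]; [simpl; lra|]. apply Rmult_le_compat_l; auto. simpl.
      apply Rmult_le_compat_l; [lra|]. apply pow_incr; split; auto using Cmod_ge_0. }
    rewrite S_INR. simpl pow.
    assert (A : r * r * (Cmod x * Cmod E) <= r * (INR n * (INR n - 1) / 2 * r ^ n * (h * h))).
    { apply Rle_trans with (r * (r * r * Cmod E)); [|apply Rmult_le_compat_l; lra].
      assert (0 <= r * r * Cmod E) by (apply Rmult_le_pos; nra). nra. }
    assert (B : r * r * (INR n * Cmod y ^ pred n * (h * h)) <= r * (INR n * r ^ n * (h * h))).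
    { replace (r * r * (INR n * Cmod y ^ pred n * (h * h)))
        with (r * (h * h) * (INR n * (r * Cmod y ^ pred n))) by ring.
      replace (r * (INR n * r ^ n * (h * h))) with (r * (h * h) * (INR n * r ^ n)) by ring.
      apply Rmult_le_compat_l; auto. apply Rmult_le_pos; nra. }
    apply Rmult_le_compat_l with (r := r * r) in T; [|nra]. nra.
Qed.

Lemma pow_lipschitz (x y : C) (n : nat) : Cmod x = 1 -> Cmod y = 1 ->
  Cmod (x ^ n - y ^ n)%C <= INR n * Cmod (x - y)%C.
Proof.
  intros Hx Hy. induction n as [|n IH].
  - replace (x ^ 0 - y ^ 0)%C with (RtoC 0) by (simpl; ring). rewrite Cmod_0; simpl; lra.
  - replace (x ^ S n - y ^ S n)%C with (x * (x ^ n - y ^ n) + (x - y) * y ^ n)%C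
      by (simpl; ring).
    rewrite S_INR. eapply Rle_trans; [apply Cmod_triangle|].
    rewrite !Cmod_mult, Cmod_pow, Hx, Hy, pow1. lra.
Qed.

(** The weight (n + 1)^2 dominates every weight that occurs later: 1, n, n + 1 and n (n - 1) / 2. *)
Lemma ex_series_sqr_geom (q : R) : 0 <= q < 1 ->
  ex_series (fun n => (INR n + 1) * (INR n + 1) * q ^ n).
Proof.
  assert (Pos : forall p, 0 < p < 1 -> ex_series (fun n => (INR n + 1) * (INR n + 1) * p ^ n)).
  { intros p Hp.
    assert (P : forall n, 0 < (INR n + 1) * (INR n + 1) * p ^ n).
    { intros n. assert (H := pos_INR n). apply Rmult_lt_0_compat; [nra | apply pow_lt; lra]. }
    apply ex_series_ext with (fun n => Rabs ((INR n + 1) * (INR n + 1) * p ^ n)).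
    { intros n. apply Rabs_pos_eq, Rlt_le, P. }
    apply ex_series_DAlembert with p; [lra | intros n; apply Rgt_not_eq, P |].
    apply is_lim_seq_ext with (fun n => (1 + / (INR (S n))) * (1 + / INR (S n)) * p).
    { intros n. rewrite Rabs_pos_eq by (apply Rlt_le, Rdiv_lt_0_compat; apply P).
      assert (H := pos_INR n). assert (p ^ n <> 0) by (apply pow_nonzero; lra).
      rewrite S_INR. simpl. field. split; auto; lra. }
    assert (L : is_lim_seq (fun n => 1 + / INR (S n)) (1 + 0)).
    { apply is_lim_seq_plus'; [apply is_lim_seq_const|].
      apply (is_lim_seq_incr_1 (fun n => / INR n)).
      replace (Finite 0) with (Rbar_inv p_infty) by reflexivity.
      apply is_lim_seq_inv; [apply is_lim_seq_INR | discriminate]. }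
    replace (Finite p) with (Finite ((1 + 0) * (1 + 0) * p)) by (f_equal; ring).
    apply is_lim_seq_mult'; [apply is_lim_seq_mult'; auto | apply is_lim_seq_const]. }
  (* At [q = 0] the terms vanish from index 1 on, where the ratio test is void; the series with
     ratio 1/2 dominates instead. *)
  intros [[H | <-] H1]; [apply Pos; auto|].
  apply (@ex_series_le R_AbsRing R_CompleteNormedModule) with
    (fun n => (INR n + 1) * (INR n + 1) * (/ 2) ^ n); [|apply Pos; lra].
  intros n. simpl. unfold norm; simpl; unfold abs; simpl.
  assert (Hn := pos_INR n).
  assert (0 <= 0 ^ n) by (apply pow_le; lra).
  rewrite Rabs_pos_eq by (apply Rmult_le_pos; nra).
  apply Rmult_le_compat_l; [nra|]. apply pow_incr; lra.
Qed.

Lemma Cmod_terms_bounded (x : nat -> C) (l : C) :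
  cseries x l -> exists B, forall n, Cmod (x n) <= B.
Proof.
  intros H. rewrite cseries_eps in H. destruct (H 1 Rlt_0_1) as [N HN].
  assert (F : forall N, exists B, forall n, (n <= N)%nat -> Cmod (x n) <= B).
  { clear. induction N as [|N [B HB]].
    - exists (Cmod (x 0%nat)). intros n Hn. replace n with 0%nat by lia. lra.
    - exists (Rmax B (Cmod (x (S N)))). intros n Hn.
      destruct (Nat.eq_dec n (S N)) as [-> | E]; [apply Rmax_r|].
      apply Rle_trans with B; [apply HB; lia | apply Rmax_l]. }
  (* Beyond [N] a term is the difference of two consecutive partial sums, each within 1 of the
     limit: hence the 2. *)
  destruct (F N) as [B HB]. exists (Rmax B 2). intros n.
  destruct (Nat.le_gt_cases n N) as [L | L].
  - apply Rle_trans with B; [auto | apply Rmax_l].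
  - apply Rle_trans with 2; [|apply Rmax_r]. destruct n as [|n]; [lia|].
    assert (A := HN n ltac:(lia)). assert (A' := HN (S n) ltac:(lia)).
    rewrite sum_Sn in A'. change plus with Cplus in A'.
    assert (T := Cmod_triangle (csum x n + x (S n) - l) (- (csum x n - l))).
    rewrite Cmod_opp in T.
    replace (csum x n + x (S n) - l + - (csum x n - l))%C with (x (S n)) in T by ring.
    lra.
Qed.

(** For [t] strictly between [r] and 1 the terms at [t] are bounded by some [B], so
    [Cmod (c n) * r ^ n] is at most [B * (r / t) ^ n], and the geometric factor absorbs the
    weight. *)
Lemma disk_abs_summable (g : C -> C) (c : nat -> C) (r : R) :
  series_on_disk g c -> 0 <= r < 1 ->
  ex_series (fun n => (INR n + 1) * (INR n + 1) * (Cmod (c n) * r ^ n)).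
Proof.
  intros H Hr. set (t := (1 + r) / 2).
  assert (Ht : r < t < 1) by (unfold t; lra).
  assert (Hd : in_disk (RtoC t)).
  { unfold in_disk. rewrite Cmod_R, Rabs_pos_eq; lra. }
  apply H in Hd. apply (proj1 (pseries_cseries _ _ _)) in Hd.
  destruct (Cmod_terms_bounded _ _ Hd) as [B HB].
  apply (@ex_series_le R_AbsRing R_CompleteNormedModule) with
    (fun n => B * ((INR n + 1) * (INR n + 1) * (r / t) ^ n)).
  - intros n. unfold norm; simpl; unfold abs; simpl.
    assert (Hn := pos_INR n). assert (Hc := Cmod_ge_0 (c n)).
    assert (Hrn : 0 <= r ^ n) by (apply pow_le; lra).
    rewrite Rabs_pos_eq by (apply Rmult_le_pos; nra).
    specialize (HB n). rewrite Cmod_mult, Cmod_pow, Cmod_R, Rabs_pos_eq in HB by lra.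
    replace (B * ((INR n + 1) * (INR n + 1) * (r / t) ^ n))
      with ((INR n + 1) * (INR n + 1) * (B * (r / t) ^ n)) by ring.
    apply Rmult_le_compat_l; [nra|].
    unfold Rdiv. rewrite Rpow_mult_distr, pow_inv.
    assert (Htn : 0 < t ^ n) by (apply pow_lt; lra).
    apply Rmult_le_reg_r with (t ^ n); auto.
    replace (B * (r ^ n * / t ^ n) * t ^ n) with (B * r ^ n) by (field; lra). nra.
  - apply (@ex_series_scal_l R_AbsRing R_NormedModule B
      (fun n => (INR n + 1) * (INR n + 1) * (r / t) ^ n)), ex_series_sqr_geom.
    split; [apply Rdiv_le_0_compat; lra|].
    apply Rmult_lt_reg_r with t; [lra|]. unfold Rdiv; rewrite Rmult_assoc, Rinv_l; lra.
Qed.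

Lemma cseries_decr_1 (x : nat -> C) (l : C) : x 0%nat = 0%C ->
  cseries (fun n => x (S n)) l -> cseries x l.
Proof.
  intros E H. apply is_series_decr_1. rewrite E.
  change (cseries (fun n => x (S n)) (l - 0)%C).
  replace (l - 0)%C with l by ring. exact H.
Qed.

(** The formally differentiated series converges to some [d]. Summing [pow_taylor] over n gives |g x
    - g z - (x - z) d| <= K |x - z|^2, so [d] is a derivative of [g] at [z], and derivatives are
    unique. *)
Lemma series_on_disk_deriv (g g1 : C -> C) (c : nat -> C) :
  series_on_disk g c -> (forall z, in_disk z -> cderiv g z (g1 z)) ->
  series_on_disk g1 (fun n => RtoC (INR (S n)) * c (S n))%C.
Proof.
  intros H Hg z Hz. unfold in_disk in Hz. assert (Gz := Cmod_ge_0 z).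
  set (r := (1 + Cmod z) / 2). assert (Hr : Cmod z < r < 1) by (unfold r; lra).
  set (b := fun n => (INR n + 1) * (INR n + 1) * (Cmod (c n) * r ^ n)).
  assert (Hb : ex_series b) by (apply (disk_abs_summable g); auto; lra).
  destruct (cseries_dominated (fun n => z ^ n * (RtoC (INR (S n)) * c (S n)))%C
              (fun n => / r * b (S n))) as [d Hd].
  { intros n. unfold b. rewrite !Cmod_mult, Cmod_pow, Cmod_R, Rabs_pos_eq by apply pos_INR.
    rewrite S_INR. assert (Hn := pos_INR n). assert (Hc := Cmod_ge_0 (c (S n))).
    assert (P : 0 <= Cmod z ^ n <= r ^ n) by (split; [apply pow_le | apply pow_incr]; lra).
    simpl pow.
    replace (/ r * ((INR n + 1 + 1) * (INR n + 1 + 1) * (Cmod (c (S n)) * (r * r ^ n))))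
      with ((INR n + 1 + 1) * (INR n + 1 + 1) * (Cmod (c (S n)) * r ^ n)) by (field; lra).
    apply Rle_trans with ((INR n + 1) * (Cmod (c (S n)) * r ^ n)).
    - replace (Cmod z ^ n * ((INR n + 1) * Cmod (c (S n))))
        with ((INR n + 1) * (Cmod (c (S n)) * Cmod z ^ n)) by ring.
      apply Rmult_le_compat_l; [lra|]. apply Rmult_le_compat_l; lra.
    - apply Rmult_le_compat_r; [apply Rmult_le_pos; lra | nra]. }
  { apply (@ex_series_scal_l R_AbsRing R_NormedModule (/ r) (fun n => b (S n))).
    apply -> (@ex_series_incr_1 R_AbsRing R_NormedModule b). auto. }
  assert (Hd' : cseries (fun n => RtoC (INR n) * z ^ pred n * c n)%C d).
  { apply cseries_decr_1; [simpl; ring|].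
    apply cseries_ext with (2 := Hd). intros n; simpl pred. ring. }
  set (K := / (r * r) * Series b).
  assert (Hrr : 0 < / (r * r)) by (apply Rinv_0_lt_compat; nra).
  assert (Hb0 : forall n, 0 <= b n).
  { intros n. unfold b. assert (Hn := pos_INR n).
    apply Rmult_le_pos; [nra | apply Rmult_le_pos; [apply Cmod_ge_0 | apply pow_le; lra]]. }
  assert (Q : forall x, Cmod x <= r ->
    Cmod (g x - g z - (x - z) * d)%C <= K * (Cmod (x - z)%C * Cmod (x - z)%C)).
  { intros x Hx.
    assert (Sx := H x ltac:(unfold in_disk; lra)). assert (Sz := H z Hz).
    apply (proj1 (pseries_cseries _ _ _)) in Sx, Sz.
    assert (A := cseries_minus _ _ _ _ (cseries_minus _ _ _ _ Sx Sz) (cseries_scal (x - z)%C _ _ Hd')).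
    set (h := Cmod (x - z)%C) in *.
    replace (K * (h * h)) with ((/ (r * r) * (h * h)) * Series b) by (unfold K; ring).
    apply cseries_Cmod_le with (2 := A) (y := fun n => (/ (r * r) * (h * h)) * b n).
    2:{ apply (@is_series_scal_l R_AbsRing R_NormedModule (/ (r * r) * (h * h)) b).
        apply Series_correct; auto. }
    intros n.
    replace (x ^ n * c n - z ^ n * c n - (x - z) * (RtoC (INR n) * z ^ pred n * c n))%C
      with ((x ^ n - z ^ n - RtoC (INR n) * z ^ pred n * (x - z)) * c n)%C by ring.
    rewrite Cmod_mult.
    assert (T := pow_taylor x z r n ltac:(lra) Hx ltac:(lra)). fold h in T.
    set (E := Cmod (x ^ n - z ^ n - RtoC (INR n) * z ^ pred n * (x - z))%C) in *.
    assert (Hn := pos_INR n). assert (Hrn : 0 <= r ^ n) by (apply pow_le; lra).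
    assert (Hc := Cmod_ge_0 (c n)). assert (Hh : 0 <= h) by apply Cmod_ge_0.
    apply Rmult_le_reg_l with (r * r); [nra|].
    replace (r * r * (/ (r * r) * (h * h) * b n)) with ((h * h) * b n) by (field; lra).
    rewrite <- Rmult_assoc. apply Rle_trans with (INR n * (INR n - 1) / 2 * r ^ n * (h * h) * Cmod (c n)).
    - apply Rmult_le_compat_r; auto.
    - unfold b. replace (INR n * (INR n - 1) / 2 * r ^ n * (h * h) * Cmod (c n))
        with (h * h * (INR n * (INR n - 1) / 2 * (Cmod (c n) * r ^ n))) by field.
      apply Rmult_le_compat_l; [nra|]. apply Rmult_le_compat_r; [apply Rmult_le_pos; auto | nra]. }
  apply (proj2 (pseries_cseries _ _ _)).
  replace (g1 z) with d; [exact Hd|].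
  destruct (Ceq_dec d (g1 z)) as [|N]; auto. exfalso.
  apply Cminus_eq_contra, Cmod_gt_0 in N. set (del := Cmod (d - g1 z)%C) in *.
  destruct (Hg z Hz) as [_ D]. specialize (D z (fun P HP => HP)).
  assert (Hdel : 0 < del / 3) by lra.
  destruct (D (mkposreal _ Hdel)) as [eta Heta].
  assert (HK : 0 <= K).
  { unfold K. apply Rmult_le_pos; [lra|].
    assert (Eb : forall n, Rabs (b n) = b n) by (intros n; apply Rabs_pos_eq; auto).
    rewrite <- (Series_ext _ _ Eb).
    eapply Rle_trans; [apply Rabs_pos | apply Series_Rabs].
    apply ex_series_ext with b; auto. }
  (* A real increment within the differentiability radius, inside the disk of radius [r], and with K
     t <= del / 3: the two remainders then total at most 2/3 del t, less than |t (d - g1 z)| = del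
     t. *)
  set (t := Rmin (eta / 2) (Rmin (r - Cmod z) (del / 3 / (K + 1)))).
  assert (Ht : 0 < t).
  { unfold t. apply Rmin_glb_lt; [destruct eta; simpl; lra|].
    apply Rmin_glb_lt; [lra | apply Rdiv_lt_0_compat; lra]. }
  assert (T1 : t < eta).
  { apply Rle_lt_trans with (eta / 2); [apply Rmin_l | destruct eta; simpl; lra]. }
  assert (T2 : t <= r - Cmod z).
  { eapply Rle_trans; [apply Rmin_r | apply Rmin_l]. }
  assert (T3 : t * (K + 1) <= del / 3).
  { apply Rle_trans with (del / 3 / (K + 1) * (K + 1)); [|right; field; lra].
    apply Rmult_le_compat_r; [lra|]. eapply Rle_trans; [apply Rmin_r | apply Rmin_r]. }
  set (x := (z + RtoC t)%C).
  assert (Ex : (x - z = RtoC t)%C) by (unfold x; ring).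
  assert (Ct : Cmod (RtoC t) = t) by (rewrite Cmod_R, Rabs_pos_eq; lra).
  assert (Bx : Cmod (x - z)%C < eta) by (rewrite Ex, Ct; auto).
  specialize (Heta x Bx).
  change (Cmod (g x - g z - (x - z) * g1 z)%C <= del / 3 * Cmod (x - z)%C) in Heta.
  assert (Hx : Cmod x <= r).
  { unfold x. eapply Rle_trans; [apply Cmod_triangle|]. lra. }
  specialize (Q x Hx). rewrite Ex, Ct in *.
  assert (W := Cmod_triangle (g x - g z - RtoC t * g1 z) (- (g x - g z - RtoC t * d))).
  rewrite Cmod_opp in W.
  replace (g x - g z - RtoC t * g1 z + - (g x - g z - RtoC t * d))%C
    with (RtoC t * (d - g1 z))%C in W by ring.
  rewrite Cmod_mult, Ct in W. fold del in W. nra.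
Qed.

Lemma series_on_disk_plus (f g : C -> C) (a b : nat -> C) :
  series_on_disk f a -> series_on_disk g b ->
  series_on_disk (fun z => f z + g z)%C (fun n => a n + b n)%C.
Proof. intros Ha Hb z Hz. apply (is_pseries_plus a b); auto. Qed.

Lemma series_on_disk_scal (k : C) (f : C -> C) (a : nat -> C) :
  series_on_disk f a -> series_on_disk (fun z => k * f z)%C (fun n => k * a n)%C.
Proof. intros Ha z Hz. apply (is_pseries_scal k a); auto. apply Cmult_comm. Qed.

Lemma series_on_disk_shift (f : C -> C) (a : nat -> C) :
  series_on_disk f a ->
  series_on_disk (fun z => z * f z)%C (fun n => match n with O => 0 | S k => a k end)%C.
Proof. intros Ha z Hz. apply (is_pseries_incr_1 a); auto. Qed.

Lemma series_on_disk_ext (f g : C -> C) (a b : nat -> C) :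
  (forall z, f z = g z) -> (forall n, a n = b n) ->
  series_on_disk f a -> series_on_disk g b.
Proof.
  intros E F Ha z Hz. rewrite <- E. apply (is_pseries_ext a); auto.
Qed.

(** The operator sends z^(n+1) to (n+1) (gam + del n + (del - gam) n (n-1) / 2) z^n, and the second
    factor is itself (n+1) (2 gam + (del - gam) n) / 2. The resulting square (n+1)^2 is the source
    of n^2 in the coefficient bound. *)
Lemma Lop_series (gam del : R) (g g1 g2 g3 : C -> C) (c : nat -> C) :
  series_on_disk g c -> derivs3_on_disk g g1 g2 g3 ->
  series_on_disk (Lop gam del g1 g2 g3)
    (fun n => RtoC ((INR n + 1) * (INR n + 1) / 2 * (2 * gam + (del - gam) * INR n)) * c (S n))%C.
Proof.
  intros H D.
  assert (H1 := series_on_disk_deriv g g1 c H (fun z Hz => proj1 (D z Hz))).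
  assert (H2 := series_on_disk_deriv g1 g2 _ H1 (fun z Hz => proj1 (proj2 (D z Hz)))).
  assert (H3 := series_on_disk_deriv g2 g3 _ H2 (fun z Hz => proj2 (proj2 (D z Hz)))).
  assert (K1 := series_on_disk_scal (RtoC gam) _ _ H1).
  assert (K2 := series_on_disk_scal (RtoC del) _ _ (series_on_disk_shift _ _ H2)).
  assert (K3 := series_on_disk_scal (RtoC ((del - gam) / 2)) _ _
     (series_on_disk_shift _ _ (series_on_disk_shift _ _ H3))).
  apply series_on_disk_ext with
    (3 := series_on_disk_plus _ _ _ _ (series_on_disk_plus _ _ _ _ K1 K2) K3).
  - intros z; unfold Lop; ring.
  - intros n. destruct n as [|[|n]].
    + apply injective_projections; simpl; field.
    + apply injective_projections; simpl; field.
    + rewrite !S_INR. apply injective_projections; simpl; field.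
Qed.

(** * Caratheodory's inequality and the coefficient bound *)

Lemma polar1_pow (a : R) (n : nat) : (polar 1 a ^ n)%C = polar 1 (INR n * a).
Proof.
  induction n as [|n IH].
  - unfold polar; simpl. rewrite Rmult_0_l, cos_0, sin_0.
    apply injective_projections; simpl; ring.
  - rewrite Cpow_S, IH, S_INR. unfold polar.
    replace ((INR n + 1) * a) with (a + INR n * a) by ring.
    rewrite cos_plus, sin_plus. apply injective_projections; simpl; ring.
Qed.

Lemma polar1_neq_1 (a : R) : 0 < a < 2 * PI -> polar 1 a <> 1%C.
Proof.
  intros H E. injection E as E _.
  replace a with (2 * (a / 2)) in E by field. rewrite cos_2a_sin in E.
  assert (0 < sin (a / 2)) by (apply sin_gt_0; lra). nra.
Qed.

Lemma csum_scal (a : C) (x : nat -> C) (n : nat) :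
  csum (fun k => a * x k)%C n = (a * csum x n)%C.
Proof. apply (@sum_n_scal_l C_AbsRing C_NormedModule a x). Qed.

Lemma csum_plus (x y : nat -> C) (n : nat) :
  csum (fun k => x k + y k)%C n = (csum x n + csum y n)%C.
Proof. apply (@sum_n_plus C_NormedModule x y). Qed.

Lemma csum_ext (x y : nat -> C) (n : nat) :
  (forall k, x k = y k) -> csum x n = csum y n.
Proof. intros; apply sum_n_ext; auto. Qed.

Lemma csum_1 (n : nat) : csum (fun _ => RtoC 1) n = RtoC (INR (S n)).
Proof.
  induction n as [|n IH]; [rewrite sum_O; auto|].
  rewrite sum_Sn, IH, (S_INR (S n)), RtoC_plus. reflexivity.
Qed.

Lemma csum_geom (q : C) (n : nat) :
  ((q - 1) * csum (fun k => q ^ k) n = q ^ S n - 1)%C.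
Proof.
  induction n as [|n IH]; [rewrite sum_O; simpl; ring|].
  rewrite sum_Sn. change plus with Cplus.
  transitivity ((q - 1) * csum (fun k => q ^ k) n + (q - 1) * q ^ S n)%C; [ring|].
  rewrite IH; simpl; ring.
Qed.

Lemma polar1_root_of_unity (m : nat) : (polar 1 (2 * PI / INR (S m)) ^ S m)%C = 1%C.
Proof.
  rewrite polar1_pow. assert (0 < INR (S m)) by (apply lt_0_INR; lia).
  replace (INR (S m) * (2 * PI / INR (S m))) with (2 * PI) by (field; lra).
  unfold polar. rewrite cos_2PI, sin_2PI.
  apply injective_projections; simpl; ring.
Qed.

Lemma csum_roots_of_unity (m p : nat) : (0 < p < S m)%nat ->
  csum (fun j => (polar 1 (2 * PI / INR (S m)) ^ j) ^ p)%C m = 0%C.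
Proof.
  intros Hp. set (om := polar 1 (2 * PI / INR (S m))).
  assert (HM : 0 < INR (S m)) by (apply lt_0_INR; lia).
  assert (Hp1 : 0 < INR p) by (apply lt_0_INR; lia).
  assert (Hp2 : INR p < INR (S m)) by (apply lt_INR; lia).
  assert (Pi := PI_RGT_0).
  rewrite (csum_ext _ (fun j => (om ^ p) ^ j)%C).
  2:{ intros j. rewrite <- !Cpow_mult_r. f_equal; lia. }
  assert (G := csum_geom (om ^ p)%C m).
  assert (E : ((om ^ p) ^ S m = 1)%C).
  { rewrite <- Cpow_mult_r, Nat.mul_comm, Cpow_mult_r. unfold om at 1.
    rewrite polar1_root_of_unity. apply Cpow_1_l. }
  assert (N : (om ^ p - 1 <> 0)%C).
  { apply Cminus_eq_contra. unfold om. rewrite polar1_pow. apply polar1_neq_1.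
    replace (INR p * (2 * PI / INR (S m))) with (2 * PI * (INR p / INR (S m))) by (field; lra).
    assert (0 < INR p / INR (S m)) by (apply Rdiv_lt_0_compat; auto).
    assert (INR p / INR (S m) < 1).
    { apply Rmult_lt_reg_r with (INR (S m)); auto. unfold Rdiv.
      rewrite Rmult_assoc, Rinv_l; lra. }
    split; nra. }
  rewrite E in G. destruct (Ceq_dec (csum (fun j => (om ^ p) ^ j)%C m) 0) as [Z | Z]; auto.
  exfalso. apply (Cmult_neq_0 _ _ N Z). rewrite G; ring.
Qed.

Lemma Re_csum (x : nat -> C) (n : nat) : Re (csum x n) = sum_n (fun k => Re (x k)) n.
Proof.
  induction n as [|n IH]; [rewrite !sum_O; auto|].
  rewrite !sum_Sn, <- IH. reflexivity.
Qed.

Lemma sum_n_ge_const (x : nat -> R) (a : R) (n : nat) :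
  (forall k, a <= x k) -> INR (S n) * a <= sum_n x n.
Proof.
  intros H. induction n as [|n IH]; [rewrite sum_O; simpl; specialize (H O); lra|].
  rewrite sum_Sn, (S_INR (S n)). change plus with Rplus. specialize (H (S n)). lra.
Qed.

(** For nonzero [x], v = -x / |x|. The minus sign turns the nonnegativity of a weighted average into
    an upper bound for |x|. *)
Lemma unit_opposing (x : C) :
  exists v, Cmod v = 1 /\ (Cconj v * x)%C = RtoC (- Cmod x).
Proof.
  destruct (Ceq_dec x 0) as [-> | N].
  - exists 1%C. split; [apply Cmod_1|]. rewrite Cmod_0.
    apply injective_projections; simpl; ring.
  - apply Cmod_gt_0 in N. exists (RtoC (- / Cmod x) * x)%C. split.
    + rewrite Cmod_mult, Cmod_R, Rabs_Ropp, Rabs_pos_eq; [field; lra|].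
      apply Rlt_le, Rinv_0_lt_compat; auto.
    + replace (Cconj (RtoC (- / Cmod x) * x) * x)%C with (RtoC (- / Cmod x) * (x * Cconj x))%C
        by (apply injective_projections; simpl; ring).
      rewrite <- Cmod2_conj, <- RtoC_mult. f_equal. field; lra.
Qed.

(* Average the polynomial against the nonnegative Fejer-type weight
   [2 + 2 Re (v w^n)] over the [N + n + 1]-st roots of unity [w]: only the
   coefficients of index [0] and [n] survive. *)
Lemma caratheodory_poly (c : nat -> C) (N n : nat) (tau : R) :
  (1 <= n <= N)%nat -> 0 <= tau ->
  (forall w, Cmod w = 1 -> - tau <= Re (csum (fun k => w ^ k * c k)%C N)) ->
  Cmod (c n) <= 2 * Re (c 0%nat) + 4 * tau.
Proof.
  intros Hn Ht H. destruct (unit_opposing (c n)) as [v [Hv Ev]].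
  (* With N + n + 1 nodes, the exponents k and k + n for k <= N stay below the number of nodes, so
     only the exponent 0 survives among them, while k + N + 1 is a multiple of that number only for
     k = n. *)
  set (m := (N + n)%nat). set (w := fun j => (polar 1 (2 * PI / INR (S m)) ^ j)%C).
  assert (Hw : forall j, Cmod (w j) = 1).
  { intros j. unfold w. rewrite Cmod_pow, Cmod_polar1; apply pow1. }
  assert (wM : forall j, (w j ^ S m = 1)%C).
  { intros j. unfold w. rewrite <- Cpow_mult_r, Nat.mul_comm, Cpow_mult_r.
    rewrite polar1_root_of_unity. apply Cpow_1_l. }
  assert (Z : forall p, (0 < p < S m)%nat -> csum (fun j => w j ^ p)%C m = 0%C)
    by apply csum_roots_of_unity.
  (* On these nodes [w j ^ S N] is the conjugate of [w j ^ n]; written as a power, it reduces every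
     product to power sums. *)
  set (W := fun j => (2 + v * w j ^ n + Cconj v * w j ^ S N)%C).
  assert (Mono : forall k, csum (fun j => w j ^ k * W j)%C m =
     (2 * csum (fun j => w j ^ k) m + v * csum (fun j => w j ^ (k + n)) m
      + Cconj v * csum (fun j => w j ^ (k + S N)) m)%C).
  { intros k. rewrite <- !csum_scal, <- !csum_plus. apply csum_ext. intros j.
    unfold W. rewrite !Cpow_add_r. ring. }
  assert (Tot : forall K, (K <= N)%nat ->
     csum (fun j => csum (fun k => w j ^ k * c k)%C K * W j)%C m
     = (RtoC (INR (S m)) * (2 * c 0%nat + (if (n <=? K)%nat then Cconj v * c n else 0)))%C).
  { induction K as [|K IH]; intros HK.
    - rewrite (csum_ext _ (fun j => c 0%nat * (w j ^ 0 * W j))%C)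
        by (intros j; rewrite sum_O; ring).
      rewrite csum_scal, Mono. simpl (0 + _)%nat. rewrite (Z n), (Z (S N)) by (unfold m; lia).
      simpl Cpow. rewrite csum_1. destruct (Nat.leb_spec n 0); [lia|]. ring.
    - rewrite (csum_ext _ (fun j => csum (fun k => w j ^ k * c k)%C K * W j
                                   + c (S K) * (w j ^ S K * W j))%C)
        by (intros j; rewrite sum_Sn; change plus with Cplus; ring).
      rewrite csum_plus, IH, csum_scal, Mono by lia.
      rewrite (Z (S K)), (Z (S K + n)%nat) by (unfold m; lia).
      destruct (Nat.lt_trichotomy (S K) n) as [L | [L | L]].
      + rewrite (Z (S K + S N)%nat) by (unfold m; lia).
        destruct (Nat.leb_spec n K); [lia|]. destruct (Nat.leb_spec n (S K)); [lia|]. ring.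
      + rewrite (csum_ext (fun j => w j ^ (S K + S N))%C (fun _ => RtoC 1)), csum_1.
        2:{ intros j. rewrite <- (wM j). f_equal. unfold m; lia. }
        destruct (Nat.leb_spec n K); [lia|]. destruct (Nat.leb_spec n (S K)); [|lia].
        rewrite L. ring.
      + rewrite (csum_ext (fun j => w j ^ (S K + S N))%C (fun j => w j ^ (S K - n))%C).
        2:{ intros j. replace (S K + S N)%nat with (S K - n + S m)%nat by (unfold m; lia).
            rewrite Cpow_add_r, wM. ring. }
        rewrite (Z (S K - n)%nat) by (unfold m; lia).
        destruct (Nat.leb_spec n K); [|lia]. destruct (Nat.leb_spec n (S K)); [|lia]. ring. }
  assert (Wr : forall j, W j = RtoC (2 + 2 * Re (v * w j ^ n)%C)).
  { intros j. unfold W. replace (w j ^ S N)%C with (Cconj (w j ^ n)).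
    - apply injective_projections; simpl; ring.
    - assert (E : (w j ^ n * w j ^ S N = 1)%C).
      { rewrite <- Cpow_add_r, <- (wM j). f_equal. unfold m; lia. }
      assert (F : (w j ^ n * Cconj (w j ^ n) = 1)%C).
      { rewrite <- Cmod2_conj, Cmod_pow, Hw, !pow1; auto. }
      rewrite <- (Cmult_1_r (Cconj (w j ^ n))), <- E, Cmult_assoc.
      rewrite (Cmult_comm (Cconj (w j ^ n))), F. apply Cmult_1_l. }
  specialize (Tot N (le_n N)). destruct (Nat.leb_spec n N); [|lia]. rewrite Ev in Tot.
  apply (f_equal Re) in Tot. rewrite re_scal_l, Re_csum in Tot.
  assert (L : INR (S m) * (- (4 * tau)) <= INR (S m) * (2 * Re (c 0%nat) - Cmod (c n))).
  { replace (2 * Re (c 0%nat) - Cmod (c n)) with (Re (2 * c 0%nat + RtoC (- Cmod (c n)))%C)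
      by (generalize (Cmod (c n)); intros; unfold Re; simpl; ring).
    rewrite <- Tot. apply sum_n_ge_const. intros j.
    rewrite Wr, re_scal_r.
    (* The weight lies in [0, 4], so a real part of at least -tau costs at most 4 tau. *)
    assert (Q := re_le_Cmod (v * w j ^ n)%C).
    rewrite Cmod_mult, Hv, Cmod_pow, Hw, pow1 in Q. apply Rabs_le_between in Q.
    specialize (H (w j) (Hw j)). nra. }
  apply Rmult_le_reg_l in L; [lra | apply lt_0_INR; lia].
Qed.

Lemma cseries_tail (x : nat -> C) (b : nat -> R) (l : C) (B : R) (N : nat) :
  (forall k, Cmod (x k) <= b k) -> cseries x l -> is_series b B ->
  Cmod (l - csum x N)%C <= B - sum_n b N.
Proof.
  intros H Hx Hb.
  apply cseries_Cmod_le with (x := fun k => x (S N + k)%nat) (y := fun k => b (S N + k)%nat).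
  - auto.
  - apply is_series_incr_n; [lia|]. simpl pred.
    change (cseries x (l - csum x N + csum x N)%C).
    replace (l - csum x N + csum x N)%C with l by ring. auto.
  - apply is_series_incr_n; [lia|]. simpl pred.
    change (is_series b (B - sum_n b N + sum_n b N)).
    replace (B - sum_n b N + sum_n b N) with B by ring. auto.
Qed.

Lemma bernoulli_le (t : R) (n : nat) : 0 <= t <= 1 -> 1 - INR n * t <= (1 - t) ^ n.
Proof.
  intros H. induction n as [|n IH]; [simpl; lra|].
  rewrite S_INR. simpl. assert (Hn := pos_INR n).
  assert (0 <= INR n * t * t) by (apply Rmult_le_pos; nra). nra.
Qed.

(** On radius r < 1 the partial sums of large index are uniformly within [e] of [f], so the
    polynomial version applies with [tau = e]. The passages e -> 0 and r -> 1 are made by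
    contradiction, with explicit choices. *)
Theorem caratheodory (f : C -> C) (c : nat -> C) (n : nat) :
  series_on_disk f c -> (forall z, in_disk z -> 0 <= Re (f z)) -> (1 <= n)%nat ->
  Cmod (c n) <= 2 * Re (c 0%nat).
Proof.
  intros Hs Hf Hn.
  assert (A : forall r, 0 <= r < 1 -> Cmod (c n) * r ^ n <= 2 * Re (c 0%nat)).
  { intros r Hr. set (b := fun k => Cmod (c k) * r ^ k).
    assert (Hb : ex_series b).
    { apply (@ex_series_le R_AbsRing R_CompleteNormedModule) with (2 := disk_abs_summable f c r Hs Hr).
      intros k. unfold norm; simpl; unfold abs; simpl. unfold b.
      assert (P : 0 <= Cmod (c k) * r ^ k)
        by (apply Rmult_le_pos; [apply Cmod_ge_0 | apply pow_le; lra]).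
      rewrite Rabs_pos_eq by auto. assert (Hk := pos_INR k).
      rewrite <- (Rmult_1_l (Cmod (c k) * r ^ k)) at 1. apply Rmult_le_compat_r; auto. nra. }
    apply Series_correct in Hb. set (B := Series b) in *.
    (* One eighth of the supposed excess: the loss 4 e is then only half of it. *)
    apply Rnot_lt_le; intros L. set (e := (Cmod (c n) * r ^ n - 2 * Re (c 0%nat)) / 8).
    assert (He : 0 < e) by (unfold e; lra).
    assert (Hl : is_lim_seq (sum_n b) B) by exact Hb.
    apply is_lim_seq_spec in Hl. destruct (Hl (mkposreal e He)) as [N0 HN].
    set (N := max N0 n). specialize (HN N ltac:(unfold N; lia)). simpl in HN.
    apply Rabs_lt_between in HN.
    assert (Q : Cmod (c n * RtoC (r ^ n))%C <= 2 * Re (c 0%nat * RtoC (r ^ 0))%C + 4 * e).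
    { apply (caratheodory_poly (fun k => c k * RtoC (r ^ k))%C N n e);
        [unfold N; lia | lra |].
      intros w Hw.
      assert (D : in_disk (RtoC r * w)%C).
      { unfold in_disk. rewrite Cmod_mult, Cmod_R, Rabs_pos_eq, Hw; lra. }
      assert (S := Hs _ D). apply (proj1 (pseries_cseries _ _ _)) in S.
      apply cseries_ext with (y := fun k => (w ^ k * (c k * RtoC (r ^ k)))%C) in S.
      2:{ intros k. rewrite Cpow_mult_l, RtoC_pow. ring. }
      assert (Hbk : forall k, Cmod (w ^ k * (c k * RtoC (r ^ k)))%C <= b k).
      { intros k. unfold b.
        rewrite !Cmod_mult, Cmod_pow, Hw, pow1, Cmod_R, Rabs_pos_eq; [lra|].
        apply pow_le; lra. }
      assert (T := cseries_tail _ b _ B N Hbk S Hb).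
      assert (F := Hf _ D).
      set (s := csum (fun k => w ^ k * (c k * RtoC (r ^ k)))%C N) in *.
      assert (R1 := re_le_Cmod (f (RtoC r * w)%C - s)%C). apply Rabs_le_between in R1.
      change (Re (f (RtoC r * w)%C - s)%C) with (Re (f (RtoC r * w)%C) - Re s) in R1.
      lra. }
    rewrite Cmod_mult, Cmod_R, Rabs_pos_eq, re_scal_r in Q by (apply pow_le; lra).
    simpl pow in Q. unfold e in Q. lra. }
  (* Radius 0 gives 0 <= 2 Re (c 0), which makes the [t] chosen below at most 1. *)
  assert (P := A 0 ltac:(lra)). rewrite pow_ne_zero in P by lia.
  apply Rnot_lt_le; intros L. set (s := 2 * Re (c 0%nat)) in *.
  set (a := Cmod (c n)) in *. assert (Hn1 : 1 <= INR n) by (apply (le_INR 1); lia).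
  rewrite Rmult_0_r in P.
  assert (Hna : a <= INR n * a) by nra.
  (* Chosen so that Bernoulli's inequality gives a (1 - t)^n >= a - n t a = (a + s) / 2 > s. *)
  set (t := (a - s) / (2 * INR n * a)).
  assert (E : t * (2 * INR n * a) = a - s) by (unfold t; field; lra).
  assert (Ht : 0 < t) by (apply Rdiv_lt_0_compat; lra).
  assert (t <= 1) by nra.
  assert (Q := A (1 - t) ltac:(lra)). assert (Bn := bernoulli_le t n ltac:(lra)).
  nra.
Qed.

Lemma cseries_delta (i : nat) (k : C) :
  cseries (fun n => if Nat.eq_dec n i then k else RtoC 0) k.
Proof.
  apply cseries_eps. intros eps Heps. exists i. intros n Hn.
  assert (E : forall n, csum (fun n => if Nat.eq_dec n i then k else RtoC 0) n
                        = if le_dec i n then k else RtoC 0).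
  { clear. induction n as [|n IH].
    - rewrite sum_O. destruct (Nat.eq_dec 0 i), (le_dec i 0); auto; lia.
    - rewrite sum_Sn, IH. change plus with Cplus.
      destruct (Nat.eq_dec (S n) i), (le_dec i n), (le_dec i (S n)); try lia; ring. }
  rewrite E. destruct (le_dec i n); [|lia].
  replace (k - k)%C with (RtoC 0) by ring. rewrite Cmod_0; auto.
Qed.

Lemma series_on_disk_const (k : C) :
  series_on_disk (fun _ => k) (fun n => if Nat.eq_dec n 0 then k else RtoC 0).
Proof.
  intros z _. apply (proj2 (pseries_cseries _ _ _)).
  apply cseries_ext with (2 := cseries_delta 0 k). intros n.
  destruct (Nat.eq_dec n 0) as [-> | N]; [simpl; ring|].
  ring.
Qed.

(** The rotation [u] turns [y] into the direction of [x]. Choosing it separately for each index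
    converts a bound on a combination with [u] into one on the sum of the two moduli. *)
Lemma Cmod_aligned (x y : C) :
  exists u, Cmod u = 1 /\ Cmod (x + u * y)%C = Cmod x + Cmod y.
Proof.
  destruct (unit_opposing x) as [v [Hv Ev]], (unit_opposing y) as [w [Hw Ew]].
  exists (v * Cconj w)%C. split; [rewrite Cmod_mult, Cmod_conj, Hv, Hw; ring|].
  assert (E : (Cconj v * (x + v * Cconj w * y))%C = RtoC (- (Cmod x + Cmod y))).
  { assert (F : (Cconj v * v = 1)%C).
    { rewrite Cmult_comm, <- Cmod2_conj, Hv, pow1; auto. }
    transitivity (Cconj v * x + (Cconj v * v) * (Cconj w * y))%C; [ring|].
    rewrite F, Ev, Ew. apply injective_projections; simpl; ring. }
  apply (f_equal Cmod) in E. rewrite Cmod_mult, Cmod_conj, Hv, Cmod_R, Rabs_Ropp in E.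
  rewrite Rabs_pos_eq in E by (generalize (Cmod_ge_0 x), (Cmod_ge_0 y); lra). lra.
Qed.

Lemma RH0_coefficient_bound (gam del lam : R) (s s1 s2 s3 t t1 t2 t3 : C -> C)
  (a b : nat -> C) (n : nat) :
  0 <= lam < gam -> gam <= del ->
  a 1%nat = 1%C -> b 1%nat = 0%C -> series_on_disk s a -> series_on_disk t b ->
  derivs3_on_disk s s1 s2 s3 -> derivs3_on_disk t t1 t2 t3 ->
  (forall z, in_disk z ->
    Re (Lop gam del s1 s2 s3 z - RtoC lam)%C > Cmod (Lop gam del t1 t2 t3 z)) ->
  (2 <= n)%nat ->
  INR n * INR n * (Cmod (a n) + Cmod (b n)) <= 4 * ((gam - lam) / (gam + del)).
Proof.
  intros Hl Hd Ha1 Hb1 Hs Ht Ds Dt H Hn.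
  assert (Ls := Lop_series gam del s s1 s2 s3 a Hs Ds).
  assert (Lt := Lop_series gam del t t1 t2 t3 b Ht Dt).
  destruct n as [|n]; [lia|].
  set (k := fun n => (INR n + 1) * (INR n + 1) / 2 * (2 * gam + (del - gam) * INR n)) in *.
  destruct (Cmod_aligned (RtoC (k n) * a (S n)) (RtoC (k n) * b (S n))) as [u [Hu Eu]].
  assert (A := caratheodory _ _ n
    (series_on_disk_plus _ _ _ _
      (series_on_disk_plus _ _ _ _ Ls (series_on_disk_const (- RtoC lam)))
      (series_on_disk_scal u _ _ Lt))).
  cbv beta in A.
  change (if Nat.eq_dec 0 0 then (- RtoC lam)%C else RtoC 0) with (- RtoC lam)%C in A.
  assert (Hn1 : 1 <= INR n) by (apply (le_INR 1); lia).
  assert (K0 : k 0%nat = gam) by (unfold k; simpl; field).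
  (* The index has been lowered by one: z^n in the operator series carries [a (S n)]. Since
     [gam <= del], the factor 2 gam + (del - gam) n is least at n = 1, where it equals gam + del. *)
  assert (Kn : (INR n + 1) * (INR n + 1) / 2 * (gam + del) <= k n).
  { unfold k. apply Rmult_le_compat_l; nra. }
  destruct (Nat.eq_dec n 0) as [|_]; [lia|].
  fold (k n) in A. fold (k 0%nat) in A.
  replace (RtoC (k n) * a (S n) + 0 + u * (RtoC (k n) * b (S n)))%C
    with (RtoC (k n) * a (S n) + u * (RtoC (k n) * b (S n)))%C in A by ring.
  rewrite Eu, !Cmod_mult, Cmod_R, Rabs_pos_eq in A by (apply Rle_trans with (2 := Kn); nra).
  rewrite Ha1, Hb1 in A.
  replace (RtoC (k 0%nat) * 1 + - RtoC lam + u * (RtoC (k 0%nat) * 0))%C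
    with (RtoC (gam - lam)) in A by (rewrite K0, RtoC_minus; ring).
  rewrite re_RtoC in A.
  assert (Q : k n * Cmod (a (S n)) + k n * Cmod (b (S n)) <= 2 * (gam - lam)).
  { apply A; [|lia]. intros z Hz. specialize (H z Hz).
    assert (R1 := re_le_Cmod (u * Lop gam del t1 t2 t3 z)%C).
    rewrite Cmod_mult, Hu in R1. apply Rabs_le_between in R1.
    change (Re (Lop gam del s1 s2 s3 z) - lam > Cmod (Lop gam del t1 t2 t3 z)) in H.
    change (0 <= Re (Lop gam del s1 s2 s3 z) + - lam + Re (u * Lop gam del t1 t2 t3 z)%C).
    lra. }
  rewrite S_INR.
  apply Rmult_le_reg_r with (gam + del); [lra|].
  replace (4 * ((gam - lam) / (gam + del)) * (gam + del)) with (4 * (gam - lam)) by (field; lra).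
  assert (0 <= Cmod (a (S n)) + Cmod (b (S n)))
    by (generalize (Cmod_ge_0 (a (S n))), (Cmod_ge_0 (b (S n))); lra).
  nra.
Qed.

(** * Convexity of perturbed circles *)

(* [S0] perturbs the circle [rho w].  If [S0] is a sum of terms
   [A w^n + conj (B w^n)], then [S1] is the sum of the
   [n (A w^n - conj (B w^n))] and [S2] of the [n^2 (A w^n + conj (B w^n))], so
   that [i S1] and [- S2] are the first two derivatives in the argument of [w].
   The last two fields replace differentiation by differences, with increments
   measured by [Im z] to first and by [1 - Re z] to second order. *)
Record perturbation (rho kap lip : R) (S0 S1 S2 : C -> C) : Prop := {
  pert_rho : 0 <= kap < rho;
  pert_lip_ge0 : 0 <= lip;
  pert_S0 : forall w, Cmod w = 1 -> Cmod (S0 w)%C <= kap / 4;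
  pert_S1 : forall w, Cmod w = 1 -> Cmod (S1 w)%C <= kap / 2;
  pert_S12 : forall w, Cmod w = 1 ->
    Cmod (S2 w - S1 w)%C + Cmod (S2 w + S1 w)%C <= 2 * kap;
  pert_lip0 : forall w w', Cmod w = 1 -> Cmod w' = 1 ->
    Cmod (S0 w' - S0 w)%C <= kap / 2 * Cmod (w' - w)%C;
  pert_lip1 : forall w w', Cmod w = 1 -> Cmod w' = 1 ->
    Cmod (S1 w' - S1 w)%C <= kap * Cmod (w' - w)%C;
  pert_diff0 : forall w z, Cmod w = 1 -> Cmod z = 1 ->
    let D := (S0 (w * z)%C - S0 w - Ci * RtoC (Im z) * S1 w)%C in
    Cmod (D + RtoC (1 - Re z) * S1 w) + Cmod (D - RtoC (1 - Re z) * S1 w)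
      <= 2 * kap * (1 - Re z);
  pert_diff1 : forall w z, Cmod w = 1 -> Cmod z = 1 ->
    Cmod (S1 (w * z)%C - S1 w - Ci * RtoC (Im z) * S2 w) <= lip * (1 - Re z)
}.

Section Perturbation.
Context {rho kap lip : R} {S0 S1 S2 : C -> C}.
Context (P : perturbation rho kap lip S0 S1 S2).

Definition curve (w : C) : C := (RtoC rho * w + S0 w)%C.
(* [i] times this outward normal is the derivative of [curve] in the argument of [w]. *)
Definition normal (w : C) : C := (RtoC rho * w + S1 w)%C.

(** The Lipschitz constant [kap / 2] of [S0] is less than the factor [rho] of the main term. *)
Lemma curve_inj (w w' : C) :
  Cmod w = 1 -> Cmod w' = 1 -> curve w = curve w' -> w = w'.
Proof.
  intros H H' E. destruct (pert_rho _ _ _ _ _ _ P) as [K0 K1].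
  assert (L := pert_lip0 _ _ _ _ _ _ P w w' H H').
  unfold curve in E.
  replace (S0 w' - S0 w)%C with (RtoC rho * (w - w'))%C in L.
  2:{ transitivity ((RtoC rho * w + S0 w) - RtoC rho * w' - S0 w)%C; [ring|].
      rewrite E; ring. }
  rewrite Cmod_RtoC_mult in L by lra.
  rewrite (Cmod_minus_sym w' w) in L.
  assert (G := Cmod_ge_0 (w - w')).
  apply Ceq_minus, Cmod_le_0_eq. nra.
Qed.

Lemma normal_bounds (w : C) :
  Cmod w = 1 -> rho / 2 <= Cmod (normal w)%C <= 2 * rho.
Proof.
  intros H. destruct (pert_rho _ _ _ _ _ _ P) as [K0 K1].
  assert (A := pert_S1 _ _ _ _ _ _ P w H). unfold normal. split.
  - assert (B := Cmod_triangle_rev (RtoC rho * w) (S1 w)).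
    rewrite Cmod_RtoC_mult, H in B by lra. lra.
  - assert (B := Cmod_triangle (RtoC rho * w) (S1 w)).
    rewrite Cmod_RtoC_mult, H in B by lra. lra.
Qed.

Lemma curve_bound (w : C) : Cmod w = 1 -> Cmod (curve w)%C <= 2 * rho.
Proof.
  intros H. destruct (pert_rho _ _ _ _ _ _ P) as [K0 K1].
  assert (A := pert_S0 _ _ _ _ _ _ P w H). unfold curve.
  assert (B := Cmod_triangle (RtoC rho * w) (S0 w)).
  rewrite Cmod_RtoC_mult, H in B by lra. lra.
Qed.

Lemma unit_quotient (w w' : C) : Cmod w = 1 -> Cmod w' = 1 ->
  exists z, Cmod z = 1 /\ w' = (w * z)%C.
Proof.
  intros H H'. exists (w' / w)%C.
  assert (w <> 0%C) by (intros E; rewrite E, Cmod_0 in H; lra).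
  split; [rewrite Cmod_div, H, H' by auto; field | field; auto].
Qed.

(** Write z = 1 - e + i Im z. Apart from a tangential part, the chord is -Y with Y = e rho w - D;
    take X = e [normal w]. Then X - Y = D + e S1 and X + Y = 2 e rho w - (D - e S1), so [pert_diff0]
    and kap < rho give |X - Y| <= |X + Y|. *)
Lemma curve_support (w w' : C) : Cmod w = 1 -> Cmod w' = 1 ->
  dot (normal w) (curve w' - curve w) <= 0.
Proof.
  intros H H'. destruct (unit_quotient w w' H H') as [z [Hz ->]].
  destruct (pert_rho _ _ _ _ _ _ P) as [K0 K1].
  assert (A := pert_diff0 _ _ _ _ _ _ P w z H Hz). cbv zeta in A.
  set (D := (S0 (w * z)%C - S0 w - Ci * RtoC (Im z) * S1 w)%C) in A.
  set (e := 1 - Re z) in *.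
  assert (He : 0 <= e) by (unfold e; generalize (unit_Re_le z Hz); lra).
  set (Y := (RtoC (e * rho) * w - D)%C).
  (* [i * normal w] is orthogonal to [normal w], so only [- Y] contributes. *)
  assert (E : (curve (w * z)%C - curve w
               = RtoC (Im z) * (Ci * normal w) - Y)%C).
  { unfold curve, normal, Y, D, e. rewrite (Ceq_Re_Im z) at 1.
    rewrite RtoC_mult, RtoC_minus. ring. }
  assert (X : 0 <= dot (RtoC e * normal w) Y).
  { apply dot_pos_of_Cmod_le.
    replace (RtoC e * normal w - Y)%C with (D + RtoC e * S1 w)%C
      by (unfold normal, Y; rewrite RtoC_mult; ring).
    replace (RtoC e * normal w + Y)%C
      with (RtoC (2 * e * rho) * w + - (D - RtoC e * S1 w))%C
      by (unfold normal, Y; rewrite !RtoC_mult; ring).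
    assert (B := Cmod_triangle_rev (RtoC (2 * e * rho) * w) (- (D - RtoC e * S1 w))).
    rewrite Cmod_opp, Cmod_RtoC_mult, H in B by nra. nra. }
  assert (X' : dot (RtoC e * normal w) Y = e * dot (normal w) Y).
  { unfold dot; destruct (normal w), Y; simpl; ring. }
  rewrite X' in X.
  assert (R1 : dot (normal w) (curve (w * z)%C - curve w) = - dot (normal w) Y).
  { rewrite E; unfold dot; destruct (normal w), Y; simpl; ring. }
  destruct He as [He | He].
  - rewrite R1. nra.
  (* For e = 0 the factor e cannot be cancelled, but |z - 1|^2 = 2 e leaves only the point
     itself. *)
  - assert (z = 1%C).
    { apply Ceq_minus, Cmod_le_0_eq.
      assert (U := unit_dist_1 z Hz). fold e in U.
      assert (V := Cmod_ge_0 (z - 1)). nra. }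
    subst z. rewrite Cmult_1_r. unfold dot.
    replace (curve w - curve w)%C with (RtoC 0) by ring. simpl; lra.
Qed.

(** When [S1] and [S2] come from derivatives of [S0] as intended, this product is the curvature
    times |normal w|^3. The bound [pert_S12] gives |X - Y| < |X + Y| for X = [normal w] and Y = rho
    w + S2. *)
Lemma curvature_pos (w : C) : Cmod w = 1 ->
  0 < dot (normal w) (RtoC rho * w + S2 w).
Proof.
  intros H. destruct (pert_rho _ _ _ _ _ _ P) as [K0 K1].
  assert (A := pert_S12 _ _ _ _ _ _ P w H).
  apply dot_pos_of_Cmod_lt. unfold normal.
  replace (RtoC rho * w + S1 w - (RtoC rho * w + S2 w))%C
    with (- (S2 w - S1 w))%C by ring.
  replace (RtoC rho * w + S1 w + (RtoC rho * w + S2 w))%C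
    with (RtoC (2 * rho) * w + (S2 w + S1 w))%C by (rewrite RtoC_mult; ring).
  assert (B := Cmod_triangle_rev (RtoC (2 * rho) * w) (S2 w + S1 w)).
  rewrite Cmod_RtoC_mult, H in B by lra. rewrite Cmod_opp. lra.
Qed.

(** Tested at s = a / m with m = |a| + |c| + 1: this s lies in [-1, 1], a s = m s^2, and m > c. *)
Lemma linear_le_quadratic (a c : R) :
  (forall s, -1 <= s <= 1 -> a * s <= c * (s * s)) -> a = 0.
Proof.
  intros H. destruct (Req_dec a 0) as [|Ha]; auto. exfalso.
  set (m := Rabs a + Rabs c + 1).
  assert (A := Rabs_pos a). assert (B := Rabs_pos c).
  assert (Hm : 0 < m) by (unfold m; lra).
  assert (A2 : - Rabs a <= a <= Rabs a) by (apply Rabs_le_between; lra).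
  assert (B1 := Rle_abs c).
  specialize (H (a / m)).
  assert (Q : a / m * m = a) by (field; lra).
  assert (- 1 <= a / m <= 1).
  { split; apply Rmult_le_reg_r with m; auto; rewrite Q; unfold m; lra. }
  specialize (H H0). set (q := a / m) in *.
  assert (0 < q * q). { assert (q <> 0) by (intros E; rewrite E in Q; lra). nra. }
  assert (a * q = (q * q) * m) by (rewrite <- Q at 1; ring).
  assert (c < m) by (unfold m; lra). nra.
Qed.

Definition inside (p : C) : Prop :=
  forall w, Cmod w = 1 -> dot (normal w) (p - curve w) <= 0.

(** On the tangent line, p = curve w + x i T. The half-plane at the nearby point w z with Im z = s
    then reads (x - s) (s [dot T U] + O(s^2)) <= O(s^2), that is, x s [dot T U] <= O(s^2) for s of
    either sign. Hence x [dot T U] = 0, and x = 0 by positive curvature. *)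
Lemma inside_tangent (p w : C) : Cmod w = 1 -> inside p ->
  dot (normal w) (p - curve w) = 0 -> p = curve w.
Proof.
  intros H Hp E. destruct (pert_rho _ _ _ _ _ _ P) as [K0 K1].
  assert (L0 := pert_lip_ge0 _ _ _ _ _ _ P).
  assert (Tb := normal_bounds w H).
  set (T := normal w) in *.
  assert (T2 := Cmod_sqr T).
  assert (Tp : 0 < dot T T) by nra.
  set (x := dot (Ci * T) (p - curve w) / dot T T).
  assert (Ep : (p - curve w = RtoC x * (Ci * T))%C).
  { unfold x; apply orthogonal_decomposition; auto. }
  set (U := (RtoC rho * w + S2 w)%C).
  assert (k := curvature_pos w H). fold T in k. fold U in k.
  assert (x * dot T U = 0) as X.
  { apply linear_le_quadratic with
      (Rabs x * ((lip + rho) * Cmod T) + dot T U + (lip + rho) * Cmod T + 2 * rho * (rho + kap)).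
    intros s Hs.
    (* The unit number with imaginary part [s] in the right half-plane, where 1 - Re z <= s^2. *)
    set (z := (sqrt (1 - s * s), s) : C).
    assert (Hq : 0 <= 1 - s * s) by nra.
    assert (Hz : Cmod z = 1).
    { unfold Cmod, z; simpl. rewrite !Rmult_1_r.
      rewrite sqrt_sqrt by auto. replace (1 - s * s + s * s) with 1 by ring. apply sqrt_1. }
    assert (Hr : 0 <= Re z) by (simpl; apply sqrt_pos).
    assert (Hi : Im z = s) by reflexivity.
    assert (Hu := unit_eq z Hz). rewrite Hi in Hu.
    assert (Hr1 := unit_Re_le z Hz).
    set (e := 1 - Re z).
    assert (He : 0 <= e <= s * s) by (unfold e; nra).
    assert (Hw : Cmod (w * z)%C = 1) by (rewrite Cmod_mult, H, Hz; ring).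
    assert (D0 := pert_diff0 _ _ _ _ _ _ P w z H Hz). cbv zeta in D0.
    assert (D1 := pert_diff1 _ _ _ _ _ _ P w z H Hz).
    set (D := (S0 (w * z)%C - S0 w - Ci * RtoC (Im z) * S1 w)%C) in *.
    set (E1 := (S1 (w * z)%C - S1 w - Ci * RtoC (Im z) * S2 w)%C) in *.
    fold e in D0, D1.
    assert (DD : Cmod D <= kap * e).
    { assert (Q := Cmod_triangle (D + RtoC e * S1 w) (D - RtoC e * S1 w)).
      replace (D + RtoC e * S1 w + (D - RtoC e * S1 w))%C with (RtoC 2 * D)%C in Q by ring.
      rewrite Cmod_RtoC_mult in Q by lra. lra. }
    set (E2 := (E1 - RtoC (e * rho) * w)%C).
    assert (HE2 : Cmod E2 <= (lip + rho) * e).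
    { unfold E2. assert (Q := Cmod_triangle E1 (- (RtoC (e * rho) * w))).
      rewrite Cmod_opp, Cmod_RtoC_mult, H in Q by nra.
      change (E1 - RtoC (e * rho) * w)%C with (E1 + - (RtoC (e * rho) * w))%C. lra. }
    set (E0 := (D - RtoC (e * rho) * w)%C).
    assert (HE0 : Cmod E0 <= (rho + kap) * e).
    { unfold E0. assert (Q := Cmod_triangle D (- (RtoC (e * rho) * w))).
      rewrite Cmod_opp, Cmod_RtoC_mult, H in Q by nra.
      change (D - RtoC (e * rho) * w)%C with (D + - (RtoC (e * rho) * w))%C. lra. }
    assert (ET : normal (w * z)%C = (T + RtoC s * (Ci * U) + E2)%C).
    { unfold T, normal, U, E2, E1, e. rewrite Hi. rewrite (Ceq_Re_Im z) at 1.
      rewrite Hi, RtoC_mult, RtoC_minus. ring. }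
    assert (EG : (p - curve (w * z)%C = RtoC x * (Ci * T) - RtoC s * (Ci * T) - E0)%C).
    { rewrite <- Ep. unfold T, normal, curve, E0, D, e. rewrite Hi.
      rewrite (Ceq_Re_Im z) at 1. rewrite Hi, RtoC_mult, RtoC_minus. ring. }
    assert (Hp' := Hp (w * z)%C Hw). rewrite EG in Hp'.
    assert (Tb' := normal_bounds (w * z)%C Hw).
    assert (B0 := dot_le (normal (w * z)%C) E0).
    set (N := normal (w * z)%C) in *.
    assert (Hd : dot N (RtoC x * (Ci * T) - RtoC s * (Ci * T) - E0)
               = (x - s) * (s * dot T U + dot E2 (Ci * T)) - dot N E0).
    { replace (dot N (RtoC x * (Ci * T) - RtoC s * (Ci * T) - E0)) with
       ((x - s) * dot N (Ci * T) - dot N E0).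
      - rewrite ET at 1. unfold dot; destruct T, U, E2, E0; simpl; ring.
      - unfold dot; destruct N, T, E0; simpl; ring. }
    rewrite Hd in Hp'.
    assert (CT : Cmod (Ci * T)%C = Cmod T) by (rewrite Cmod_mult, Cmod_Ci; ring).
    assert (B2 := dot_le_Cmod E2 (Ci * T)). rewrite CT in B2.
    set (d := dot E2 (Ci * T)) in *.
    assert (B3 : Rabs d <= (lip + rho) * Cmod T * e).
    { apply Rle_trans with (1 := B2). generalize (Cmod_ge_0 T); nra. }
    assert (B4 : dot N E0 <= 2 * rho * (rho + kap) * e).
    { apply Rle_trans with (1 := B0).
      assert (0 <= Cmod E0) by apply Cmod_ge_0.
      apply Rle_trans with (2 * rho * Cmod E0); nra. }
    assert (B5 : Rabs (x * d) <= Rabs x * ((lip + rho) * Cmod T * e)).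
    { rewrite Rabs_mult. apply Rmult_le_compat_l; auto using Rabs_pos. }
    assert (B6 : Rabs (s * d) <= (lip + rho) * Cmod T * e).
    { rewrite Rabs_mult. assert (Rabs s <= 1) by (apply Rabs_le; exact Hs).
      assert (0 <= Rabs d) by apply Rabs_pos. assert (0 <= Rabs s) by apply Rabs_pos. nra. }
    apply Rabs_le_between in B5; apply Rabs_le_between in B6.
    assert (F : x * dot T U * s <= s * s * dot T U
       + (Rabs x * ((lip + rho) * Cmod T) + (lip + rho) * Cmod T + 2 * rho * (rho + kap)) * e) by nra.
    apply Rle_trans with (1 := F).
    assert (0 <= Rabs x * ((lip + rho) * Cmod T) + (lip + rho) * Cmod T + 2 * rho * (rho + kap)).
    { assert (0 <= (lip + rho) * Cmod T) by (apply Rmult_le_pos; [lra | apply Cmod_ge_0]).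
      assert (0 <= Rabs x) by apply Rabs_pos.
      assert (0 <= 2 * rho * (rho + kap)) by nra.  nra. }
    nra. }
  assert (x = 0) by nra.
  rewrite H0 in Ep. apply Ceq_minus. rewrite Ep. ring.
Qed.

Lemma inside_curve (w : C) : Cmod w = 1 -> inside (curve w).
Proof. intros H w' H'; apply curve_support; auto. Qed.

Lemma inside_near (p q w : C) : Cmod w = 1 ->
  dot (normal w) (p - curve w) <= dot (normal w) (q - curve w) + 2 * rho * Cmod (q - p)%C.
Proof.
  intros H. assert (A := dot_le (normal w) (p - q)).
  assert (B := normal_bounds w H). rewrite (Cmod_minus_sym p q) in A.
  assert (G := Cmod_ge_0 (q - p)).
  replace (dot (normal w) (p - curve w))
    with (dot (normal w) (q - curve w) + dot (normal w) (p - q)) by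
    (unfold dot, Re, Im; simpl; ring).
  nra.
Qed.

Lemma inside_closed (p : C) : closure_pt inside p -> inside p.
Proof.
  intros Hp w H. destruct (pert_rho _ _ _ _ _ _ P) as [K0 K1].
  apply Rnot_lt_le; intros L.
  (* The functional of a half-plane is Lipschitz with constant 2 rho, so within this radius it
     changes by at most half of the supposed violation. *)
  destruct (Hp (dot (normal w) (p - curve w) / (4 * rho))) as [q [Hq E]].
  { apply Rdiv_lt_0_compat; lra. }
  assert (A := inside_near p q w H). assert (B := Hq w H).
  apply Rmult_lt_compat_l with (r := 4 * rho) in E; [|lra].
  replace (4 * rho * (dot (normal w) (p - curve w) / (4 * rho)))
    with (dot (normal w) (p - curve w)) in E by (field; lra). lra.
Qed.

Lemma inside_convex : convex_set inside.
Proof.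
  intros x y u Hx Hy Hu w H. assert (A := Hx w H). assert (B := Hy w H).
  replace (dot (normal w) (RtoC (1 - u) * x + RtoC u * y - curve w))
    with ((1 - u) * dot (normal w) (x - curve w) + u * dot (normal w) (y - curve w))
    by (unfold dot, Re, Im; simpl; ring).
  nra.
Qed.

(** The half-plane whose [w] points towards [p] gives (rho - kap / 2) |p| <=
    [dot (normal w) (curve w)] <= 4 rho^2. *)
Lemma inside_bounded (p : C) : inside p -> Cmod p <= 8 * rho.
Proof.
  intros Hp. destruct (pert_rho _ _ _ _ _ _ P) as [K0 K1].
  destruct (Rle_lt_dec (Cmod p) 0) as [N | N]; [lra|].
  set (w := (RtoC (/ Cmod p) * p)%C).
  assert (Ip : 0 < / Cmod p) by (apply Rinv_0_lt_compat; auto).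
  assert (H : Cmod w = 1) by (unfold w; rewrite Cmod_RtoC_mult by lra; field; lra).
  assert (Ew : p = (RtoC (Cmod p) * w)%C).
  { unfold w. rewrite Cmult_assoc, <- RtoC_mult, Rinv_r, Cmult_1_l by lra; auto. }
  clearbody w.
  assert (A := Hp w H). assert (B := dot_le (normal w) (curve w)).
  assert (C1 := normal_bounds w H). assert (C2 := curve_bound w H).
  assert (D := dot_ge_opp_Cmod (S1 w) p). assert (F := pert_S1 _ _ _ _ _ _ P w H).
  assert (U := unit_eq w H).
  replace (dot (normal w) (p - curve w))
    with (rho * dot w p + dot (S1 w) p - dot (normal w) (curve w)) in A
    by (unfold normal, curve, dot, Re, Im; simpl; ring).
  replace (dot w p) with (Cmod p) in A.
  2:{ rewrite Ew at 2. unfold dot. rewrite re_scal_l, im_scal_l.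
      transitivity (Cmod p * (Re w * Re w + Im w * Im w)); [rewrite U|]; ring. }
  assert (G1 := Cmod_ge_0 (normal w)). assert (G2 := Cmod_ge_0 (curve w)).
  assert (dot (normal w) (curve w) <= 4 * rho * rho) by nra.
  assert (- (kap / 2 * Cmod p) <= dot (S1 w) p) by nra.
  assert (rho / 2 * Cmod p <= 4 * rho * rho) by nra.
  nra.
Qed.

Lemma inside_interior : interior_pt inside 0%C.
Proof.
  destruct (pert_rho _ _ _ _ _ _ P) as [K0 K1].
  (* At 0 every half-plane has slack at least rho^2 (1 - 1/4 - 1/2 - 1/8) = rho^2 / 8, and normals
     have length at most 2 rho. *)
  exists (rho / 16). split; [lra|]. intros q Hq w H.
  replace (q - 0)%C with q in Hq by ring.
  assert (B := dot_le (normal w) q). assert (C1 := normal_bounds w H).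
  assert (F1 := pert_S1 _ _ _ _ _ _ P w H). assert (F0 := pert_S0 _ _ _ _ _ _ P w H).
  assert (D1 := dot_ge_opp_Cmod w (S0 w)). assert (D2 := dot_ge_opp_Cmod (S1 w) w).
  assert (D3 := dot_ge_opp_Cmod (S1 w) (S0 w)). rewrite H in D1, D2.
  assert (U := unit_eq w H).
  replace (dot (normal w) (q - curve w))
    with (dot (normal w) q - rho * rho * (Re w * Re w + Im w * Im w)
          - rho * dot w (S0 w) - rho * dot (S1 w) w - dot (S1 w) (S0 w))
    by (unfold normal, curve, dot, Re, Im; simpl; ring).
  rewrite U. assert (G := Cmod_ge_0 q).
  assert (G1 := Cmod_ge_0 (S1 w)). assert (G0 := Cmod_ge_0 (S0 w)).
  assert (dot (normal w) q <= rho * rho / 8) by nra.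
  assert (Cmod (S1 w) * Cmod (S0 w) <= rho / 2 * (rho / 4)) by nra.
  assert (rho * dot w (S0 w) >= - (rho * rho / 4)) by nra.
  assert (rho * dot (S1 w) w >= - (rho * rho / 2)) by nra.
  lra.
Qed.

End Perturbation.

Arguments curve : clear implicits.
Arguments normal : clear implicits.
Arguments inside : clear implicits.

(** * The boundary of the intersection of half-planes, by compactness of the circle *)

Lemma lipschitz_continuity_pt (f : R -> R) (L c : R) : 0 <= L ->
  (forall x y, Rabs (f x - f y) <= L * Rabs (x - y)) -> continuity_pt f c.
Proof.
  intros HL H eps Heps. exists (eps / (L + 1)). split.
  - apply Rdiv_lt_0_compat; lra.
  - intros x [_ Hx]. simpl in *. unfold Rdist in *.
    apply Rle_lt_trans with (1 := H x c).
    apply Rmult_lt_compat_l with (r := L + 1) in Hx; [|lra].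
    replace ((L + 1) * (eps / (L + 1))) with eps in Hx by (field; lra).
    generalize (Rabs_pos (x - c)); nra.
Qed.

Lemma dot_normal_lipschitz {rho kap lip : R} {S0 S1 S2 : C -> C}
  (P : perturbation rho kap lip S0 S1 S2) (p : C) (a b : R) :
  let phi th := dot (normal rho S1 (polar 1 th))
                  (p - curve rho S0 (polar 1 th)) in
  Rabs (phi a - phi b) <= (2 * rho * (Cmod p + 4 * rho)) * Rabs (a - b).
Proof.
  intros phi. destruct (pert_rho _ _ _ _ _ _ P) as [K0 K1].
  assert (Ha := Cmod_polar1 a). assert (Hb := Cmod_polar1 b).
  assert (W := polar1_lipschitz a b). unfold phi; clear phi.
  set (u := polar 1 a) in *. set (v := polar 1 b) in *. clearbody u v.
  assert (L0 := pert_lip0 _ _ _ _ _ _ P v u Hb Ha).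
  assert (L1 := pert_lip1 _ _ _ _ _ _ P v u Hb Ha).
  assert (G := Cmod_ge_0 (u - v)).
  assert (N : Cmod (normal rho S1 u - normal rho S1 v)%C <= 2 * rho * Rabs (a - b)).
  { replace (normal rho S1 u - normal rho S1 v)%C
      with (RtoC rho * (u - v) + (S1 u - S1 v))%C by (unfold normal; ring).
    apply Rle_trans with (1 := Cmod_triangle _ _). rewrite Cmod_RtoC_mult by lra. nra. }
  assert (M : Cmod (curve rho S0 v - curve rho S0 u)%C <= 2 * rho * Rabs (a - b)).
  { rewrite Cmod_minus_sym. replace (curve rho S0 u - curve rho S0 v)%C
      with (RtoC rho * (u - v) + (S0 u - S0 v))%C by (unfold curve; ring).
    apply Rle_trans with (1 := Cmod_triangle _ _). rewrite Cmod_RtoC_mult by lra. nra. }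
  assert (Nb := normal_bounds P v Hb). assert (Cb := curve_bound P u Ha).
  set (n := normal rho S1 u) in *. set (m := normal rho S1 v) in *.
  set (c := curve rho S0 u) in *. set (d := curve rho S0 v) in *. clearbody n m c d.
  replace (dot n (p - c) - dot m (p - d)) with (dot (n - m) (p - c) + dot m (d - c))
    by (unfold dot, Re, Im; simpl; ring).
  apply Rle_trans with (1 := Rabs_triang _ _).
  assert (A := dot_le_Cmod (n - m) (p - c)). assert (B := dot_le_Cmod m (d - c)).
  assert (D := Cmod_triangle p (- c)). rewrite Cmod_opp in D. fold (p - c)%C in D.
  assert (G1 := Cmod_ge_0 (n - m)). assert (G2 := Cmod_ge_0 (p - c)).
  assert (G3 := Cmod_ge_0 (d - c)). assert (G4 := Rabs_pos (a - b)).
  assert (Cmod (n - m)%C * Cmod (p - c)%C <= 2 * rho * Rabs (a - b) * (Cmod p + 2 * rho)).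
  { apply Rmult_le_compat; lra. }
  assert (Cmod m * Cmod (d - c)%C <= 2 * rho * (2 * rho * Rabs (a - b))).
  { apply Rmult_le_compat; lra || apply Cmod_ge_0. }
  nra.
Qed.

Theorem perturbed_circle_convex {rho kap lip : R} {S0 S1 S2 : C -> C}
  (P : perturbation rho kap lip S0 S1 S2) :
  convex_curve (fun p => exists th, 0 <= th < 2 * PI /\ p = curve rho S0 (polar 1 th)).
Proof.
  destruct (pert_rho _ _ _ _ _ _ P) as [K0 K1].
  exists (inside rho S0 S1). split; [apply (inside_convex)|].
  split; [exists (8 * rho); apply (inside_bounded P)|].
  split; [exists 0%C; apply (inside_interior P)|].
  intros p. split.
  - intros [th [_ ->]]. assert (H := Cmod_polar1 th). set (w := polar 1 th) in *.
    clearbody w. split.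
    + intros eps Heps. exists (curve rho S0 w). split; [apply (inside_curve P); auto|].
      replace (curve rho S0 w - curve rho S0 w)%C with (RtoC 0) by ring. rewrite Cmod_0; auto.
    + intros [eps [Heps I]]. assert (N := normal_bounds P w H).
      (* The outward step s [normal w] has length at most eps / 2, yet makes positive the functional
         that vanishes at [curve w]. *)
      set (s := eps / (4 * rho)).
      assert (Hs : 0 < s) by (apply Rdiv_lt_0_compat; lra).
      assert (Es : s * (4 * rho) = eps) by (unfold s; field; lra).
      assert (A : inside rho S0 S1 (curve rho S0 w + RtoC s * normal rho S1 w)%C).
      { apply I. replace (curve rho S0 w + RtoC s * normal rho S1 w - curve rho S0 w)%C
          with (RtoC s * normal rho S1 w)%C by ring.
        rewrite Cmod_RtoC_mult by lra. nra. }
      specialize (A w H).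
      replace (curve rho S0 w + RtoC s * normal rho S1 w - curve rho S0 w)%C
        with (RtoC s * normal rho S1 w)%C in A by ring.
      assert (Q := Cmod_sqr (normal rho S1 w)).
      replace (dot (normal rho S1 w) (RtoC s * normal rho S1 w))
        with (s * dot (normal rho S1 w) (normal rho S1 w)) in A
        by (unfold dot; rewrite re_scal_l, im_scal_l; ring).
      assert (0 < dot (normal rho S1 w) (normal rho S1 w)) by nra. nra.
  - intros [Hc Hi]. assert (Hp := inside_closed P p Hc).
    set (phi th := dot (normal rho S1 (polar 1 th)) (p - curve rho S0 (polar 1 th))).
    destruct (continuity_ab_maj phi 0 (2 * PI)) as [th [Hm Ht]].
    { generalize PI_RGT_0; lra. }
    { intros c _. apply lipschitz_continuity_pt with (2 * rho * (Cmod p + 4 * rho)).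
      - generalize (Cmod_ge_0 p); nra.
      - apply (dot_normal_lipschitz P). }
    assert (Hth := Cmod_polar1 th).
    assert (E : phi th = 0).
    { apply Rle_antisym; [apply Hp; auto|]. apply Rnot_lt_le; intros L.
      (* If the maximum were negative, a whole ball of this radius would satisfy every half-plane,
         making [p] interior. *)
      apply Hi. exists (- phi th / (2 * rho)). split; [apply Rdiv_lt_0_compat; lra|].
      intros q Hq w Hw. destruct (unit_is_polar w Hw) as [a [Ha ->]].
      assert (B := inside_near P q p (polar 1 a) Hw).
      assert (F := Hm a ltac:(lra)).
      rewrite Cmod_minus_sym in Hq.
      apply Rmult_lt_compat_l with (r := 2 * rho) in Hq; [|lra].
      replace (2 * rho * (- phi th / (2 * rho))) with (- phi th) in Hq by (field; lra).
      unfold phi in *. lra. }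
    (* The maximum may sit at 2 PI, which the parametrization omits, so the angle is chosen anew. *)
    destruct (unit_is_polar _ Hth) as [a [Ha Ea]].
    exists a. split; auto. rewrite <- Ea. apply (inside_tangent P); auto.
Qed.

(** * Harmonic series with small coefficients *)

Lemma is_series_ge0 (y : nat -> R) (Y : R) :
  (forall n, 0 <= y n) -> is_series y Y -> 0 <= Y.
Proof.
  intros H Hy. rewrite <- Cmod_0.
  apply cseries_Cmod_le with (2 := cseries_delta 0 0) (3 := Hy).
  intros n. destruct (Nat.eq_dec n 0); rewrite Cmod_0; auto.
Qed.

Lemma cseries_Cmod_pair (x x' : nat -> C) (y : nat -> R) (l l' : C) (Y : R) :
  (forall n, Cmod (x n) + Cmod (x' n) <= y n) ->
  cseries x l -> cseries x' l' -> is_series y Y -> Cmod l + Cmod l' <= Y.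
Proof.
  intros H Hx Hx' Hy.
  assert (Ey : ex_series y) by (exists Y; auto).
  assert (S1 : ex_series (fun n => Cmod (x n))).
  { apply (@ex_series_le R_AbsRing R_CompleteNormedModule) with (2 := Ey).
    intros n. unfold norm; simpl; unfold abs; simpl.
    rewrite Rabs_pos_eq by apply Cmod_ge_0. generalize (H n), (Cmod_ge_0 (x' n)); lra. }
  assert (S2 : ex_series (fun n => Cmod (x' n))).
  { apply (@ex_series_le R_AbsRing R_CompleteNormedModule) with (2 := Ey).
    intros n. unfold norm; simpl; unfold abs; simpl.
    rewrite Rabs_pos_eq by apply Cmod_ge_0. generalize (H n), (Cmod_ge_0 (x n)); lra. }
  assert (L1 := cseries_Cmod_le x _ l _ (fun n => Rle_refl _) Hx (Series_correct _ S1)).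
  assert (L2 := cseries_Cmod_le x' _ l' _ (fun n => Rle_refl _) Hx' (Series_correct _ S2)).
  rewrite <- (is_series_unique _ _ Hy).
  apply Rle_trans with (Series (fun n => Cmod (x n) + Cmod (x' n))).
  - rewrite Series_plus; auto. lra.
  - apply Series_le; auto. intros n; split; auto.
    generalize (Cmod_ge_0 (x n)), (Cmod_ge_0 (x' n)); lra.
Qed.

(** This is [pow_taylor] at y = 1 with r = 1, where |z - 1|^2 = 2 (1 - Re z). *)
Lemma unit_pow_second_difference (z : C) (n : nat) : Cmod z = 1 ->
  Cmod (z ^ n - 1 - RtoC (INR n) * (z - 1))%C <= INR n * (INR n - 1) * (1 - Re z).
Proof.
  intros Hz. assert (T := pow_taylor z 1 1 n Rlt_0_1 ltac:(lra) ltac:(rewrite Cmod_1; lra)).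
  rewrite !Cpow_1_l, pow1, unit_dist_1 in T by auto.
  replace (RtoC (INR n) * 1 * (z - 1))%C with (RtoC (INR n) * (z - 1))%C in T by ring.
  lra.
Qed.

(** Differentiation in the angle multiplies w^n by i n and its conjugate by -i n. After i is taken
    out, the factors are n and -n, hence separate [x] and [y], the latter under the conjugation. *)
Definition harmonic_term (A B : nat -> C) (x y : nat -> C) (n : nat) : C :=
  (A n * x n + Cconj (B n * y n))%C.

Lemma Cmod_harmonic_term (A B x y : nat -> C) (n : nat) (X Y : R) :
  Cmod (x n) <= X -> Cmod (y n) <= Y ->
  Cmod (harmonic_term A B x y n) <= Cmod (A n) * X + Cmod (B n) * Y.
Proof.
  intros HX HY. unfold harmonic_term.
  eapply Rle_trans; [apply Cmod_triangle|]. rewrite Cmod_conj, !Cmod_mult.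
  apply Rplus_le_compat; apply Rmult_le_compat_l; auto using Cmod_ge_0.
Qed.

Lemma INR_cases (n : nat) : n = 0%nat \/ n = 1%nat \/ 2 <= INR n.
Proof.
  destruct n as [|[|n]]; auto. right; right. apply (le_INR 2); lia.
Qed.

Lemma perturbation_of_series (rho kap : R) (A B : nat -> C) (S0 : C -> C) :
  A 0%nat = 0%C -> A 1%nat = 0%C -> B 0%nat = 0%C -> B 1%nat = 0%C ->
  is_series (fun n => INR n * INR n * (Cmod (A n) + Cmod (B n))) kap ->
  ex_series (fun n => INR n * (INR n * INR n * (Cmod (A n) + Cmod (B n)))) ->
  kap < rho ->
  (forall w, Cmod w = 1 ->
     cseries (harmonic_term A B (fun n => w ^ n)%C (fun n => w ^ n)%C) (S0 w)) ->
  exists lip S1 S2, perturbation rho kap lip S0 S1 S2.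
Proof.
  intros A0 A1 B0 B1 Hk Hk3 Hrho HS0.
  set (d := fun n => INR n * INR n * (Cmod (A n) + Cmod (B n))) in *.
  assert (Cn : forall n, 0 <= Cmod (A n) + Cmod (B n)).
  { intros n. generalize (Cmod_ge_0 (A n)), (Cmod_ge_0 (B n)); lra. }
  assert (Hn : forall n, 0 <= INR n) by apply pos_INR.
  (* Indices 0 and 1 vanish and n >= 2 elsewhere, so 1 <= n^2 / 4 and n <= n^2 / 2: the origin of
     [kap / 4] and [kap / 2]. *)
  assert (d4 : forall n, Cmod (A n) + Cmod (B n) <= / 4 * d n).
  { intros n. unfold d. destruct (INR_cases n) as [-> | [-> | L]].
    - rewrite A0, B0, Cmod_0. lra.
    - rewrite A1, B1, Cmod_0. lra.
    - specialize (Cn n). assert (4 <= INR n * INR n) by nra. nra. }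
  assert (d2 : forall n, INR n * (Cmod (A n) + Cmod (B n)) <= / 2 * d n).
  { intros n. unfold d. destruct (INR_cases n) as [-> | [-> | L]].
    - rewrite A0, B0, Cmod_0. lra.
    - rewrite A1, B1, Cmod_0. lra.
    - specialize (Cn n). assert (INR n * 2 <= INR n * INR n) by nra. nra. }
  assert (Sc : forall c, is_series (fun n => c * d n) (c * kap)).
  { intros c. apply (@is_series_scal_l R_AbsRing R_NormedModule c d); auto. }
  (* Weight n^3: the terms of [S1] carry n, and their second-order remainder another n^2. *)
  set (lip := Series (fun n => INR n * d n)).
  assert (Hk3' : is_series (fun n => INR n * d n) lip) by (apply Series_correct; exact Hk3).
  clear Hk3; rename Hk3' into Hk3.
  assert (Sc3 : forall c, is_series (fun n => c * (INR n * d n)) (c * lip)).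
  { intros c. apply (@is_series_scal_l R_AbsRing R_NormedModule c (fun n => INR n * d n)); auto. }
  assert (Pw : forall w n, Cmod w = 1 -> Cmod (w ^ n)%C = 1).
  { intros w n H. rewrite Cmod_pow, H, pow1; auto. }
  set (x1 := fun (w : C) n => (RtoC (INR n) * w ^ n)%C).
  set (y1 := fun (w : C) n => (RtoC (- INR n) * w ^ n)%C).
  set (x2 := fun (w : C) n => (RtoC (INR n * INR n) * w ^ n)%C).
  assert (N1 : forall w n, Cmod w = 1 -> Cmod (x1 w n) = INR n).
  { intros w n H. unfold x1. rewrite Cmod_mult, (Pw w n H), Cmod_R, Rabs_pos_eq; auto; lra. }
  assert (N1' : forall w n, Cmod w = 1 -> Cmod (y1 w n) = INR n).
  { intros w n H. unfold y1. rewrite Cmod_mult, (Pw w n H), Cmod_R, Rabs_Ropp, Rabs_pos_eq; auto; lra. }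
  assert (N2 : forall w n, Cmod w = 1 -> Cmod (x2 w n) = INR n * INR n).
  { intros w n H. unfold x2.
    rewrite Cmod_mult, (Pw w n H), Cmod_R, Rabs_pos_eq; [lra|]. specialize (Hn n); nra. }
  assert (Ex1 : exists S1 : C -> C, forall w, Cmod w = 1 -> cseries (harmonic_term A B (x1 w) (y1 w)) (S1 w)).
  { apply functional_choice with (R := fun w l : C => Cmod w = 1 -> cseries (harmonic_term A B (x1 w) (y1 w)) l).
    intros w. destruct (Req_dec (Cmod w) 1) as [H | H]; [|exists (RtoC 0); tauto].
    destruct (cseries_dominated (harmonic_term A B (x1 w) (y1 w)) (fun n => / 2 * d n)) as [l Hl].
    - intros n. eapply Rle_trans; [apply Cmod_harmonic_term with (X := INR n) (Y := INR n)|].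
      + rewrite N1; auto; lra.
      + rewrite N1'; auto; lra.
      + specialize (d2 n). lra.
    - eexists; apply Sc.
    - exists l; auto. }
  assert (Ex2 : exists S2 : C -> C, forall w, Cmod w = 1 -> cseries (harmonic_term A B (x2 w) (x2 w)) (S2 w)).
  { apply functional_choice with (R := fun w l : C => Cmod w = 1 -> cseries (harmonic_term A B (x2 w) (x2 w)) l).
    intros w. destruct (Req_dec (Cmod w) 1) as [H | H]; [|exists (RtoC 0); tauto].
    destruct (cseries_dominated (harmonic_term A B (x2 w) (x2 w)) (fun n => 1 * d n)) as [l Hl].
    - intros n. eapply Rle_trans;
        [apply Cmod_harmonic_term with (X := INR n * INR n) (Y := INR n * INR n)|];
        try (rewrite N2; auto; lra). unfold d; lra.
    - eexists; apply Sc.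
    - exists l; auto. }
  destruct Ex1 as [S1 HS1], Ex2 as [S2 HS2].
  (* From z = 1 - e + i Im z, the sum q n + n e equals z^n - 1 - n (z - 1), bounded by (n^2 - n) e.
     Removing n e once or twice adds n e or 2 n e to the bound. *)
  assert (Lin : forall w z, Cmod w = 1 -> Cmod z = 1 ->
    let q := fun n => (z ^ n - 1 - Ci * RtoC (Im z) * RtoC (INR n))%C in
    let e := 1 - Re z in
    0 <= e /\ (forall n, Cmod (q n + RtoC (INR n * e))%C <= e * (INR n * INR n - INR n)) /\
    (forall n, Cmod (q n - RtoC (INR n * e))%C <= e * (INR n * INR n + INR n)) /\
    (forall n, Cmod (q n) <= e * (INR n * INR n))).
  { intros w z Hw Hz q e. assert (He : 0 <= e) by (unfold e; generalize (unit_Re_le z Hz); lra).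
    assert (Q1 : forall n, Cmod (q n + RtoC (INR n * e))%C <= e * (INR n * INR n - INR n)).
    { intros n. assert (U := unit_pow_second_difference z n Hz). fold e in U.
      replace (q n + RtoC (INR n * e))%C with (z ^ n - 1 - RtoC (INR n) * (z - 1))%C; [lra|].
      unfold q, e. generalize (z ^ n)%C; intros p. rewrite (Ceq_Re_Im z) at 1.
      rewrite RtoC_mult, RtoC_minus. ring. }
    split; auto. split; auto. split; intros n.
    - assert (T := Cmod_triangle (q n + RtoC (INR n * e)) (- RtoC (2 * INR n * e))).
      rewrite Cmod_opp, Cmod_R, Rabs_pos_eq in T by (specialize (Hn n); nra).
      replace (q n + RtoC (INR n * e) + - RtoC (2 * INR n * e))%C
        with (q n - RtoC (INR n * e))%C in T by (rewrite !RtoC_mult; ring).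
      specialize (Q1 n). lra.
    - assert (T := Cmod_triangle (q n + RtoC (INR n * e)) (- RtoC (INR n * e))).
      rewrite Cmod_opp, Cmod_R, Rabs_pos_eq in T by (specialize (Hn n); nra).
      replace (q n + RtoC (INR n * e) + - RtoC (INR n * e))%C with (q n) in T by ring.
      specialize (Q1 n). lra. }
  exists lip, S1, S2. split.
  - split; auto. apply is_series_ge0 with (2 := Hk). intros n.
    apply Rmult_le_pos; [specialize (Hn n); nra | auto].
  - apply is_series_ge0 with (2 := Hk3). intros n.
    apply Rmult_le_pos; auto. apply Rmult_le_pos; [specialize (Hn n); nra | auto].
  - intros w Hw. replace (kap / 4) with (/ 4 * kap) by field.
    apply cseries_Cmod_le with (2 := HS0 w Hw) (3 := Sc (/ 4)). intros n.
    eapply Rle_trans; [apply Cmod_harmonic_term with (X := 1) (Y := 1); rewrite (Pw w n Hw); lra|].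
    specialize (d4 n); lra.
  - intros w Hw. replace (kap / 2) with (/ 2 * kap) by field.
    apply cseries_Cmod_le with (2 := HS1 w Hw) (3 := Sc (/ 2)). intros n.
    eapply Rle_trans; [apply Cmod_harmonic_term with (X := INR n) (Y := INR n);
      rewrite ?N1, ?N1' by auto; lra|].
    specialize (d2 n); lra.
  - intros w Hw.
    apply cseries_Cmod_pair with (2 := cseries_minus _ _ _ _ (HS2 w Hw) (HS1 w Hw))
      (3 := cseries_plus _ _ _ _ (HS2 w Hw) (HS1 w Hw)) (4 := Sc 2).
    intros n.
    set (p := (RtoC (INR n * INR n - INR n) * w ^ n)%C).
    set (m := (RtoC (INR n * INR n + INR n) * w ^ n)%C).
    assert (Hnn : n = 0%nat \/ 1 <= INR n).
    { destruct n; auto. right. apply (le_INR 1); lia. }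
    assert (Hp : Cmod p = INR n * INR n - INR n).
    { unfold p. rewrite Cmod_mult, (Pw w n Hw), Cmod_R, Rabs_pos_eq; [lra|].
      destruct Hnn as [-> | L]; [simpl; lra | nra]. }
    assert (Hm : Cmod m = INR n * INR n + INR n).
    { unfold m. rewrite Cmod_mult, (Pw w n Hw), Cmod_R, Rabs_pos_eq; [lra|].
      specialize (Hn n); nra. }
    replace (harmonic_term A B (x2 w) (x2 w) n - harmonic_term A B (x1 w) (y1 w) n)%C
      with (harmonic_term A B (fun _ => p) (fun _ => m) n).
    2:{ unfold harmonic_term, x1, x2, y1, p, m. generalize (w ^ n)%C; intros v.
        apply injective_projections; simpl; ring. }
    replace (harmonic_term A B (x2 w) (x2 w) n + harmonic_term A B (x1 w) (y1 w) n)%C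
      with (harmonic_term A B (fun _ => m) (fun _ => p) n).
    2:{ unfold harmonic_term, x1, x2, y1, p, m. generalize (w ^ n)%C; intros v.
        apply injective_projections; simpl; ring. }
    assert (T1 := Cmod_harmonic_term A B (fun _ => p) (fun _ => m) n _ _ (Req_le _ _ Hp) (Req_le _ _ Hm)).
    assert (T2 := Cmod_harmonic_term A B (fun _ => m) (fun _ => p) n _ _ (Req_le _ _ Hm) (Req_le _ _ Hp)).
    unfold d. lra.
  - intros w w' Hw Hw'. set (h := Cmod (w' - w)%C).
    replace (kap / 2 * h) with (h * / 2 * kap) by field.
    apply cseries_Cmod_le with (2 := cseries_minus _ _ _ _ (HS0 w' Hw') (HS0 w Hw)) (3 := Sc (h * / 2)).
    intros n. assert (L := pow_lipschitz w' w n Hw' Hw). fold h in L.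
    replace (harmonic_term A B (fun n => w' ^ n) (fun n => w' ^ n) n
             - harmonic_term A B (fun n => w ^ n) (fun n => w ^ n) n)%C
      with (harmonic_term A B (fun n => w' ^ n - w ^ n) (fun n => w' ^ n - w ^ n) n)%C.
    2:{ unfold harmonic_term. apply injective_projections; simpl; ring. }
    eapply Rle_trans; [apply Cmod_harmonic_term; exact L|].
    assert (0 <= h) by apply Cmod_ge_0. specialize (d2 n). nra.
  - intros w w' Hw Hw'. set (h := Cmod (w' - w)%C).
    replace (kap * h) with (h * kap) by ring.
    apply cseries_Cmod_le with (2 := cseries_minus _ _ _ _ (HS1 w' Hw') (HS1 w Hw)) (3 := Sc h).
    intros n. assert (L := pow_lipschitz w' w n Hw' Hw). fold h in L.
    replace (harmonic_term A B (x1 w') (y1 w') n - harmonic_term A B (x1 w) (y1 w) n)%C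
      with (harmonic_term A B (fun n => RtoC (INR n) * (w' ^ n - w ^ n))
             (fun n => RtoC (- INR n) * (w' ^ n - w ^ n)) n)%C.
    2:{ unfold harmonic_term, x1, y1. apply injective_projections; simpl; ring. }
    assert (L' : INR n * Cmod (w' ^ n - w ^ n)%C <= INR n * (INR n * h))
      by (apply Rmult_le_compat_l; auto).
    eapply Rle_trans; [apply Cmod_harmonic_term with (X := INR n * (INR n * h)) (Y := INR n * (INR n * h));
      rewrite Cmod_mult, Cmod_R, ?Rabs_Ropp, Rabs_pos_eq; auto|].
    unfold d; lra.
  - intros w z Hw Hz D. destruct (Lin w z Hw Hz) as [He [Qm [Qp _]]].
    set (q := fun n => (z ^ n - 1 - Ci * RtoC (Im z) * RtoC (INR n))%C) in *.
    set (e := 1 - Re z) in *.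
    assert (Hwz : Cmod (w * z)%C = 1) by (rewrite Cmod_mult, Hw, Hz; ring).
    assert (SD := cseries_minus _ _ _ _ (cseries_minus _ _ _ _ (HS0 _ Hwz) (HS0 w Hw))
                    (cseries_scal (Ci * RtoC (Im z)) _ _ (HS1 w Hw))).
    fold D in SD. assert (Se := cseries_scal (RtoC e) _ _ (HS1 w Hw)).
    replace (2 * kap * e) with (2 * e * kap) by ring.
    apply cseries_Cmod_pair with (2 := cseries_plus _ _ _ _ SD Se)
      (3 := cseries_minus _ _ _ _ SD Se) (4 := Sc (2 * e)).
    intros n.
    (* Adding e S1 produces q + n e in the analytic part and q - n e under the conjugation;
       subtracting it exchanges the two. *)
    set (p := (w ^ n * (q n + RtoC (INR n * e)))%C).
    set (m := (w ^ n * (q n - RtoC (INR n * e)))%C).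
    match goal with |- Cmod ?X + Cmod ?Y <= _ =>
      replace X with (harmonic_term A B (fun _ => p) (fun _ => m) n);
      [replace Y with (harmonic_term A B (fun _ => m) (fun _ => p) n) |] end.
    2,3: unfold harmonic_term, x1, y1, p, m, q; rewrite Cpow_mult_l;
      generalize (w ^ n)%C (z ^ n)%C; intros v1 v2; generalize (Im z) (INR n) e; intros;
      apply injective_projections; simpl; ring.
    assert (Hp : Cmod p <= e * (INR n * INR n - INR n)).
    { unfold p. rewrite Cmod_mult, (Pw w n Hw), Rmult_1_l; apply Qm. }
    assert (Hm : Cmod m <= e * (INR n * INR n + INR n)).
    { unfold m. rewrite Cmod_mult, (Pw w n Hw), Rmult_1_l; apply Qp. }
    assert (T1 := Cmod_harmonic_term A B (fun _ => p) (fun _ => m) n _ _ Hp Hm).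
    assert (T2 := Cmod_harmonic_term A B (fun _ => m) (fun _ => p) n _ _ Hm Hp).
    unfold d. lra.
  - intros w z Hw Hz. destruct (Lin w z Hw Hz) as [He [_ [_ Q]]].
    set (q := fun n => (z ^ n - 1 - Ci * RtoC (Im z) * RtoC (INR n))%C) in *.
    set (e := 1 - Re z) in *.
    assert (Hwz : Cmod (w * z)%C = 1) by (rewrite Cmod_mult, Hw, Hz; ring).
    replace (lip * e) with (e * lip) by ring.
    apply cseries_Cmod_le with (2 := cseries_minus _ _ _ _ (cseries_minus _ _ _ _ (HS1 _ Hwz) (HS1 w Hw))
                    (cseries_scal (Ci * RtoC (Im z)) _ _ (HS2 w Hw))) (3 := Sc3 e).
    intros n.
    set (p := (RtoC (INR n) * (w ^ n * q n))%C).
    match goal with |- Cmod ?X <= _ =>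
      replace X with (harmonic_term A B (fun _ => p) (fun _ => - p)%C n) end.
    2: unfold harmonic_term, x1, y1, x2, p, q; rewrite Cpow_mult_l;
      generalize (w ^ n)%C (z ^ n)%C; intros v1 v2; generalize (Im z) (INR n); intros;
      apply injective_projections; simpl; ring.
    assert (Hp : Cmod p <= INR n * (e * (INR n * INR n))).
    { unfold p. rewrite !Cmod_mult, (Pw w n Hw), Rmult_1_l, Cmod_R, Rabs_pos_eq by auto.
      apply Rmult_le_compat_l; [auto | apply Q]. }
    eapply Rle_trans; [apply Cmod_harmonic_term; [exact Hp | rewrite Cmod_opp; exact Hp]|].
    unfold d; lra.
Qed.

Lemma convex_curve_ext (S S' : C -> Prop) :
  (forall p, S p <-> S' p) -> convex_curve S -> convex_curve S'.
Proof.
  intros E [K [H1 [H2 [H3 H4]]]]. exists K. split; auto. split; auto. split; auto.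
  intros p. rewrite <- E. apply H4.
Qed.

Lemma perturbed_circle_onto_convex (f : C -> C) (rho kap lip : R) (S0 S1 S2 : C -> C) :
  perturbation rho kap lip S0 S1 S2 ->
  (forall w, f (RtoC rho * w)%C = curve rho S0 w) ->
  circle_onto_convex f rho.
Proof.
  intros P E.
  assert (Ep : forall th, f (polar rho th) = curve rho S0 (polar 1 th)).
  { intros th. rewrite <- E. f_equal. unfold polar.
    apply injective_projections; simpl; ring. }
  split.
  - intros a b Ha Hb. rewrite !Ep. intros F. apply polar1_inj; auto.
    apply (curve_inj P); auto using Cmod_polar1.
  - apply convex_curve_ext with (2 := perturbed_circle_convex P).
    intros p; split; intros [th [H ->]]; exists th; rewrite Ep; auto.
Qed.

Lemma convex_circle_of_coefficients (s t : C -> C) (a b : nat -> C) (M rho : R) :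
  series_on_disk s a -> series_on_disk t b ->
  a 0%nat = 0%C -> a 1%nat = 1%C -> b 0%nat = 0%C -> b 1%nat = 0%C ->
  (forall n, (2 <= n)%nat -> INR n * INR n * (Cmod (a n) + Cmod (b n)) <= 4 * M) ->
  0 <= M -> 0 < rho < 1 -> 4 * M * rho < 1 - rho ->
  circle_onto_convex (harm s t) rho.
Proof.
  intros Hs Ht a0 a1 b0 b1 Hc HM Hr Hlt.
  (* Index 1 is cleared: the term rho w is the circle being perturbed. *)
  set (A := fun n => if Nat.eq_dec n 1 then RtoC 0 else (a n * RtoC (rho ^ n))%C).
  set (B := fun n => (b n * RtoC (rho ^ n))%C).
  set (d := fun n => INR n * INR n * (Cmod (A n) + Cmod (B n))).
  assert (A0 : A 0%nat = 0%C) by (unfold A; simpl; rewrite a0; ring).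
  assert (A1 : A 1%nat = 0%C) by reflexivity.
  assert (B0 : B 0%nat = 0%C) by (unfold B; rewrite b0; ring).
  assert (B1 : B 1%nat = 0%C) by (unfold B; rewrite b1; ring).
  assert (Hrn : forall n, 0 <= rho ^ n) by (intros; apply pow_le; lra).
  assert (dpos : forall n, 0 <= d n).
  { intros n. unfold d. assert (Hn := pos_INR n).
    apply Rmult_le_pos; [nra|]. generalize (Cmod_ge_0 (A n)), (Cmod_ge_0 (B n)); lra. }
  assert (d0 : d 0%nat = 0) by (unfold d; rewrite A0, B0, Cmod_0; ring).
  assert (d1 : d 1%nat = 0) by (unfold d; rewrite A1, B1, Cmod_0; ring).
  assert (d2 : forall n, d (S (S n)) <= 4 * M * rho ^ S (S n)).
  { intros n. specialize (Hc (S (S n)) ltac:(lia)). unfold d, A, B.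
    destruct (Nat.eq_dec (S (S n)) 1) as [|_]; [lia|].
    rewrite !Cmod_mult, Cmod_R, Rabs_pos_eq by auto.
    rewrite <- Rmult_plus_distr_r, <- Rmult_assoc. apply Rmult_le_compat_r; auto. }
  assert (db : forall n, d n <= 4 * M * rho ^ n).
  { intros [|[|n]]; auto; [rewrite d0 | rewrite d1]; apply Rmult_le_pos; auto; lra. }
  assert (Rr : Rabs rho < 1) by (rewrite Rabs_pos_eq; lra).
  assert (Sd : ex_series d).
  { apply (@ex_series_le R_AbsRing R_CompleteNormedModule) with (fun n => 4 * M * rho ^ n).
    - intros n. unfold norm; simpl; unfold abs; simpl. rewrite Rabs_pos_eq; auto.
    - apply (@ex_series_scal_l R_AbsRing R_NormedModule (4 * M) (fun n => rho ^ n)).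
      apply ex_series_geom; auto. }
  assert (Sd3 : ex_series (fun n => INR n * d n)).
  { apply (@ex_series_le R_AbsRing R_CompleteNormedModule) with
      (fun n => 4 * M * ((INR n + 1) * (INR n + 1) * rho ^ n)).
    - intros n. unfold norm; simpl; unfold abs; simpl. assert (Hn := pos_INR n).
      rewrite Rabs_pos_eq by (apply Rmult_le_pos; auto).
      apply Rle_trans with (INR n * (4 * M * rho ^ n)); [apply Rmult_le_compat_l; auto|].
      replace (INR n * (4 * M * rho ^ n)) with (4 * M * (INR n * rho ^ n)) by ring.
      apply Rmult_le_compat_l; [lra|]. apply Rmult_le_compat_r; auto. nra.
    - apply (@ex_series_scal_l R_AbsRing R_NormedModule (4 * M)
        (fun n => (INR n + 1) * (INR n + 1) * rho ^ n)).
      apply ex_series_sqr_geom; lra. }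
  (* The terms from index 2 on sum to at most 4 M rho^2 / (1 - rho), which is below rho exactly when
     4 M rho < 1 - rho. *)
  assert (Hk : Series d < rho).
  { assert (Sd1 : ex_series (fun n => d (S n)))
      by (apply -> (@ex_series_incr_1 R_AbsRing R_NormedModule d); auto).
    rewrite Series_incr_1, Series_incr_1, d0, d1 by auto.
    assert (L : Series (fun n => d (S (S n))) <= Series (fun n => 4 * M * (rho * rho) * rho ^ n)).
    { apply Series_le.
      - intros n; split; auto. eapply Rle_trans; [apply d2 | simpl; right; ring].
      - apply (@ex_series_scal_l R_AbsRing R_NormedModule (4 * M * (rho * rho)) (fun n => rho ^ n)).
        apply ex_series_geom; auto. }
    rewrite Series_scal_l, Series_geom in L by auto.
    assert (4 * M * (rho * rho) * / (1 - rho) < rho).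
    { apply Rmult_lt_reg_r with (1 - rho); [lra|]. rewrite Rmult_assoc, Rinv_l by lra. nra. }
    lra. }
  (* With [S0] defined as a difference, [curve] agrees with [harm] at every [w], on or off the unit
     circle. *)
  destruct (perturbation_of_series rho (Series d) A B
              (fun w => harm s t (RtoC rho * w) - RtoC rho * w)%C)
    as [lip [S1 [S2 P]]]; auto.
  - apply Series_correct; auto.
  - intros w Hw.
    assert (D : in_disk (RtoC rho * w)%C).
    { unfold in_disk. rewrite Cmod_mult, Cmod_R, Rabs_pos_eq, Hw; lra. }
    assert (Es := Hs _ D). assert (Et := Ht _ D).
    apply (proj1 (pseries_cseries _ _ _)) in Es, Et.
    apply cseries_ext with (2 := cseries_minus _ _ _ _
      (cseries_plus _ _ _ _ Es (cseries_conj _ _ Et)) (cseries_delta 1 (RtoC rho * w)%C)).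
    intros n. unfold harmonic_term, A, B. rewrite Cpow_mult_l, RtoC_pow.
    destruct (Nat.eq_dec n 1) as [-> | N].
    + rewrite a1, b1. simpl Cpow. apply injective_projections; simpl; ring.
    + generalize (RtoC rho ^ n)%C (w ^ n)%C; intros u v.
      apply injective_projections; simpl; ring.
  - apply perturbed_circle_onto_convex with (1 := P). intros w. unfold curve. ring.
Qed.

(** * The cubic and the radius of convexity *)

(** Since sum_(n >= 2) n^2 r^(n-1) = (r^3 - 3 r^2 + 4 r) / (1 - r)^3, a root in (0, 1) is where this
    sum equals 1 / M, M = (gam - lam) / (gam + del). Its terms are at least 4 r^(n-1), with sum 4 r
    / (1 - r); so 4 M r <= 1 - r at the root. *)
Lemma pc_decomposition (gam del lam r : R) :
  pc gam del lam r
  = (del + gam) * (1 - r) ^ 3 - (gam - lam) * (r ^ 3 - 3 * r ^ 2 + 4 * r).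
Proof. unfold pc; ring. Qed.

(** The subtracted cubic is (r - 1)^3 + r + 1, hence increasing; [E] writes its difference quotient
    as a sum of squares plus 1. *)
Lemma pc_decreasing (gam del lam x y : R) : lam < gam -> 0 < del + gam ->
  0 <= x -> y <= 1 -> x < y -> pc gam del lam y < pc gam del lam x.
Proof.
  intros Hl Hd Hx Hy L. rewrite !pc_decomposition.
  assert (A : (1 - y) ^ 3 <= (1 - x) ^ 3) by (apply pow_incr; lra).
  assert (B : x ^ 3 - 3 * x ^ 2 + 4 * x < y ^ 3 - 3 * y ^ 2 + 4 * y).
  { assert (E : y ^ 3 - 3 * y ^ 2 + 4 * y - (x ^ 3 - 3 * x ^ 2 + 4 * x)
      = (y - x) * ((y - 1 + (x - 1) / 2) ^ 2 + 3 / 4 * (x - 1) ^ 2 + 1)) by field.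
    assert (0 < (y - x) * ((y - 1 + (x - 1) / 2) ^ 2 + 3 / 4 * (x - 1) ^ 2 + 1))
      by (apply Rmult_lt_0_compat; nra).
    lra. }
  apply Rmult_le_compat_l with (r := del + gam) in A; [|lra].
  apply Rmult_lt_compat_l with (r := gam - lam) in B; lra.
Qed.

Lemma pc_root (gam del lam : R) : lam < gam -> 0 < del + gam ->
  exists rc, 0 < rc < 1 /\ pc gam del lam rc = 0.
Proof.
  intros Hl Hd.
  (* [pc] is del + gam > 0 at 0 and -2 (gam - lam) < 0 at 1; the negation restores the order of
     signs that [IVT] expects. *)
  destruct (IVT (fun r => - pc gam del lam r) 0 1) as [r [Hr E]].
  - unfold pc; reg.
  - lra.
  - unfold pc; lra.
  - unfold pc; lra.
  - exists r. split; [|lra]. unfold pc in E.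
    destruct (Req_dec r 0) as [-> | N0]; [lra|]. destruct (Req_dec r 1) as [-> | N1]; lra.
Qed.

Theorem theorem21 (gam del lam : R) (s s1 s2 s3 t t1 t2 t3 : C -> C) :
  0 <= lam -> lam < gam -> gam <= del ->
  in_RH0 gam del lam s s1 s2 s3 t t1 t2 t3 ->
  (exists rc, (0 < rc < 1 /\ pc gam del lam rc = 0) /\
     (forall r, 0 < r < 1 -> pc gam del lam r = 0 -> r = rc)) /\
  (forall rc, 0 < rc < 1 -> pc gam del lam rc = 0 ->
     fully_convex_in (harm s t) rc).
Proof.
  intros Hlam Hl Hd [[a [a0 [a1 Hs]]] [[b [b0 [b1 Ht]]] [Ds [Dt H]]]].
  split.
  - destruct (pc_root gam del lam) as [rc [Hrc E]]; try lra.
    exists rc. split; auto. intros r Hr Er.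
    destruct (Rtotal_order r rc) as [L | [L | L]]; auto; exfalso.
    + assert (Q := pc_decreasing gam del lam r rc). lra.
    + assert (Q := pc_decreasing gam del lam rc r). lra.
  - intros rc Hrc E rho Hrho. set (M := (gam - lam) / (gam + del)).
    assert (HM : 0 <= M) by (apply Rdiv_le_0_compat; lra).
    assert (EM : M * (gam + del) = gam - lam) by (unfold M; field; lra).
    apply convex_circle_of_coefficients with a b M; auto; [|lra|].
    + intros n Hn. eapply RH0_coefficient_bound; eauto; lra.
    + rewrite pc_decomposition, <- EM in E.
      assert (F : (1 - rc) ^ 3 = M * (rc ^ 3 - 3 * rc ^ 2 + 4 * rc)).
      { apply Rmult_eq_reg_l with (gam + del); lra. }
      (* [4 r (1 - r)^2 <= r^3 - 3 r^2 + 4 r] on [0, 1] *)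
      assert (G : 4 * M * rc <= 1 - rc).
      { apply Rmult_le_reg_r with ((1 - rc) ^ 2); [apply pow_lt; lra|].
        assert (0 <= M * (rc * (5 * rc - 3 * rc * rc))) by
          (apply Rmult_le_pos; auto; apply Rmult_le_pos; nra).
        nra. }
      (* Strictness comes from the right side: 4 M rho <= 4 M rc <= 1 - rc < 1 - rho. *)
      nra.
Qed.
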